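(* Let $M=B_f\times{}_hF$ be a doubly warped product manifold with metric $g$ and let $P\in\mathfrak{X}(B)$. Let $\tilde r$, ${}^B\tilde r$, ${}^F\tilde r$ be the scalar curvatures of the semi-symmetric metric connections $\tilde\nabla$, ${}^B\tilde\nabla$, ${}^F\tilde\nabla$ associated with $P$. Then $$\tilde r=\frac{{}^B\tilde r}{f^2}+\frac{{}^Fr}{h^2}-n_1(n_1-1)\frac{\|\mathrm{grad}\,f\|^2}{f^2}-n_2(n_2-1)\frac{\|\mathrm{grad}\,h\|^2}{h^2}-2n_2(n-1)\frac{Ph}{h}-2n_1\frac{{}^F\Delta f}{f}-2n_2\frac{{}^B\Delta h}{h}-2n_2\,\mathrm{div}P-n_2(n+n_1-3)\pi(P).$$
   Context: $(B,g_B)$ and $(F,g_F)$ are Riemannian manifolds of dimensions $n_1$ and $n_2$, $n=n_1+n_2$, and $h:B\to(0,\infty)$, $f:F\to(0,\infty)$ are smooth. With $\rho:B\times F\to B$, $\sigma:B\times F\to F$ the projections, the doubly warped product $M=B_f\times{}_hF$ is $B\times F$ with the metric $g=(f\circ\sigma)^2\rho^*g_B+(h\circ\rho)^2\sigma^*g_F$. The functions $f,h$ and vector fields on $B$ and $F$ are identified with their lifts to $M$. $\nabla,{}^B\nabla,{}^F\nabla$ are the Levi-Civita connections of $M,B,F$ (${}^B\nabla$, ${}^F\nabla$ applied leafwise on $M$); ${}^Fr$ is the scalar curvature of $(F,g_F)$. Gradients and norms are taken with respect to $g$. ${}^B\Delta h$ is the Laplacian of $h$ on $B$ and ${}^F\Delta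 f$ the Laplacian of $f$ on $F$, i.e. the traces with respect to $g$ (over the tangent directions of $B$, resp. $F$) of the Hessians $XYh-({}^B\nabla_XY)h$, resp. $VWf-({}^F\nabla_VW)f$. For $P\in\mathfrak{X}(B)$, $\mathrm{div}P=\sum_i g({}^B\nabla_{e_i}P,e_i)$ over a $g$-orthonormal frame $(e_i)$ tangent to $B$. Put $\pi(A)=g(A,P)$. The semi-symmetric metric connection on $M$ associated with $P$ is $\tilde\nabla_AC=\nabla_AC+\pi(C)A-g(A,C)P$. For $P\in\mathfrak{X}(B)$: ${}^B\tilde\nabla_XY={}^B\nabla_XY+\pi(Y)X-g(X,Y)P$ for $X,Y\in\mathfrak{X}(B)$ (leafwise on $B\times\{q\}$ with the metric induced by $g$) and ${}^F\tilde\nabla={}^F\nabla$. Conventions: $\tilde R(A,C)D=\tilde\nabla_A\tilde\nabla_CD-\tilde\nabla_C\tilde\nabla_AD-\tilde\nabla_{[A,C]}D$, $\tilde S(C,D)=\mathrm{trace}(A\mapsto\tilde R(A,C)D)$, and likewise ${}^B\tilde S$ for ${}^B\tilde\nabla$; $\tilde r$ is the trace of $\tilde S$ with respect to $g$, and ${}^B\tilde r$ is the trace of ${}^B\tilde S$ with respect to $g_B$. *)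

(* Defs.v *)
From HB Require Import structures.
From mathcomp Require Import all_boot all_order all_algebra.
From mathcomp Require Import all_classical all_reals all_analysis.

Set Implicit Arguments.
Unset Strict Implicit.
Unset Printing Implicit Defensive.

Import Order.TTheory GRing.Theory Num.Theory.
Import numFieldNormedType.Exports.

Local Open Scope classical_set_scope.
Local Open Scope ring_scope.

(** * Smooth functions on open subsets of R^n *)

Fixpoint Ck_on {R : realType} {n : nat} (k : nat) (U : set 'rV[R]_n)
    (f : 'rV[R]_n -> R) : Prop :=
  match k with
  | 0%N => forall x, U x -> {for x, continuous f}
  | k'.+1 => (forall x, U x -> differentiable f x) /\
             forall i : 'I_n, Ck_on k' U (fun x => 'D_(delta_mx 0 i) f x)
  end.

Definition Cinfty_on {R : realType} {n : nat} (U : set 'rV[R]_n)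
  (f : 'rV[R]_n -> R) : Prop := forall k, Ck_on k U f.

(** * Smooth manifolds *)

(** The smooth structure is given by an atlas indexed by the points: [chart p]
    is a chart whose domain contains [p]. Any smooth atlas provides such a
    family, and the family determines the smooth structure. As usual for total
    functions, [chart p] is only meaningful on [chart_dom p], and its inverse
    [chart_inv p] on the image of [chart_dom p]. *)
Record smoothManifold (R : realType) (n : nat) := SmoothManifold {
  carrier :> topologicalType;
  chart_dom : carrier -> set carrier;
  chart : carrier -> carrier -> 'rV[R]_n;
  chart_inv : carrier -> 'rV[R]_n -> carrier;
  carrier_hausdorff : hausdorff_space carrier;
  carrier_second_countable : @second_countable carrier;
  mem_chart_dom : forall p, chart_dom p p;
  chart_dom_open : forall p, open (chart_dom p);
  chart_img_open : forall p, open (chart p @` chart_dom p);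
  chartK : forall p x, chart_dom p x -> chart_inv p (chart p x) = x;
  chart_continuous : forall p x, chart_dom p x -> {for x, continuous (chart p)};
  chart_inv_continuous : forall p z, (chart p @` chart_dom p) z ->
    {for z, continuous (chart_inv p)};
  chart_compatible : forall p q (j : 'I_n),
    Cinfty_on (chart p @` (chart_dom p `&` chart_dom q))
              (fun z => chart q (chart_inv p z) 0 j)
}.

(** A tangent vector at p is represented by its components in the coordinates of
    [chart p]; so T_pM is 'rV[R]_n for each p, and a vector field is a function
    into 'rV[R]_n. *)
Definition vfield {R : realType} {n : nat} (M : smoothManifold R n) : Type :=
  M -> 'rV[R]_n.

Section Manifold.
Context {R : realType} {n : nat} {M : smoothManifold R n}.
Implicit Types (p : M) (u v w : 'rV[R]_n) (X Y Z : vfield M) (f : M -> R).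

Definition smooth_fun_on (U : set M) f : Prop :=
  forall c : M, Cinfty_on (chart c @` (U `&` chart_dom c)) (f \o chart_inv c).

(** [tder f p v] is the derivative v(f) of f along the tangent vector v at p. *)
Definition tder f p v : R := 'D_v (f \o chart_inv p) (chart p p).

(** X is smooth on U if Xf is smooth for every smooth function f on an open
    subset of U. *)
Definition smooth_vfield_on (U : set M) X : Prop :=
  forall (V : set M) f, open V -> V `<=` U -> smooth_fun_on V f ->
    smooth_fun_on V (fun q => tder f q (X q)).

(** The field with constant components v in the coordinates of [chart p]; it is
    smooth on [chart_dom p] and takes the value v at p. *)
Definition coord_field p v : vfield M :=
  fun q => 'D_v (chart q \o chart_inv p) (chart p q).

(** Components [X, Y](x^i) = X(Y x^i) - Y(X x^i) for the coordinates x^i of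
    [chart p]. *)
Definition bracket X Y : vfield M := fun p =>
  \row_(i < n)
    (tder (fun q => tder (fun x => chart p x 0 i) q (Y q)) p (X p)
     - tder (fun q => tder (fun x => chart p x 0 i) q (X q)) p (Y p)).

(** ** Riemannian metrics *)

Definition bilin_field : Type := M -> 'rV[R]_n -> 'rV[R]_n -> R.

Record riemannian_metric (g : bilin_field) : Prop := RiemannianMetric {
  metric_linear : forall p a u v w, g p (a *: u + v) w = a * g p u w + g p v w;
  metric_sym : forall p u v, g p u v = g p v u;
  metric_pos : forall p u, u != 0 -> 0 < g p u u;
  metric_smooth : forall (U : set M) X Y, open U ->
    smooth_vfield_on U X -> smooth_vfield_on U Y ->
    smooth_fun_on U (fun p => g p (X p) (Y p))
}.

End Manifold.

Arguments bilin_field {R n} M.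

Section LinearAlgebra.
Context {R : realType} {n : nat}.
Implicit Types G T : 'rV[R]_n -> 'rV[R]_n -> R.

Definition gram G : 'M[R]_n := \matrix_(i, j) G (delta_mx 0 i) (delta_mx 0 j).

(** The contraction G^{ij} T_{ij}. *)
Definition metric_trace G T : R := \tr (invmx (gram G) *m gram T).

Definition orthonormal_frame G (e : 'I_n -> 'rV[R]_n) : Prop :=
  forall i j, G (e i) (e j) = (i == j)%:R.

End LinearAlgebra.

Section Connections.
Context {R : realType} {n : nat} {M : smoothManifold R n}.
Implicit Types (p : M) (u v w : 'rV[R]_n) (X Y Z : vfield M) (f : M -> R).
Implicit Types g : bilin_field M.

(** ** Gradient *)

Definition grad g f : vfield M := fun p =>
  (\row_i tder f p (delta_mx 0 i)) *m invmx (gram (g p)).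

(** ** Affine connections *)

(** [D p v Y] is the covariant derivative at p of the field Y along v in T_pM. *)
Definition covder : Type := M -> 'rV[R]_n -> vfield M -> 'rV[R]_n.

Definition nabla (D : covder) X Y : vfield M := fun p => D p (X p) Y.

(** The axioms concern fields smooth on an open set U. Fields being total
    functions, locality follows from the Leibniz rule applied to the indicator
    function of the complement of a neighbourhood, which is smooth near p. *)
Record connection (D : covder) : Prop := Connection {
  conn_linear : forall (U : set M) p a u v Y, open U -> U p ->
    smooth_vfield_on U Y -> D p (a *: u + v) Y = a *: D p u Y + D p v Y;
  conn_add : forall (U : set M) p v Y Z, open U -> U p ->
    smooth_vfield_on U Y -> smooth_vfield_on U Z ->
    D p v (fun q => Y q + Z q) = D p v Y + D p v Z;
  conn_leibniz : forall (U : set M) p v f Y, open U -> U p ->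
    smooth_fun_on U f -> smooth_vfield_on U Y ->
    D p v (fun q => f q *: Y q) = tder f p v *: Y p + f p *: D p v Y;
  conn_smooth : forall (U : set M) X Y, open U ->
    smooth_vfield_on U X -> smooth_vfield_on U Y ->
    smooth_vfield_on U (nabla D X Y)
}.

Record levi_civita g (D : covder) : Prop := LeviCivita {
  lc_connection : connection D;
  lc_torsion_free : forall (U : set M) X Y p, open U -> U p ->
    smooth_vfield_on U X -> smooth_vfield_on U Y ->
    nabla D X Y p - nabla D Y X p = bracket X Y p;
  lc_metric : forall (U : set M) X Y Z p, open U -> U p ->
    smooth_vfield_on U X -> smooth_vfield_on U Y -> smooth_vfield_on U Z ->
    tder (fun q => g q (Y q) (Z q)) p (X p)
    = g p (nabla D X Y p) (Z p) + g p (Y p) (nabla D X Z p)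
}.

(** The semi-symmetric metric connection of P, when D is the Levi-Civita
    connection of g. *)
Definition semi_symmetric g (D : covder) (P : vfield M) : covder :=
  fun p v Y => D p v Y + g p (Y p) (P p) *: v - g p v (Y p) *: P p.

(** ** Curvature *)

Definition curvature (D : covder) X Y Z : vfield M := fun p =>
  nabla D X (nabla D Y Z) p - nabla D Y (nabla D X Z) p
  - nabla D (bracket X Y) Z p.

(** Curvature and Hessian are tensorial; tangent vectors are extended to fields
    by [coord_field]. *)
Definition curvature_at (D : covder) p u v w : 'rV[R]_n :=
  curvature D (coord_field p u) (coord_field p v) (coord_field p w) p.

Definition ricci (D : covder) : bilin_field M := fun p v w =>
  \tr (lin1_mx (fun u => curvature_at D p u v w)).

Definition scalar_curvature g (D : covder) (p : M) : R :=
  metric_trace (g p) (ricci D p).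

(** ** Hessian, Laplacian, divergence *)

Definition hessian (D : covder) f : bilin_field M := fun p u v =>
  tder (fun q => tder f q (coord_field p v q)) p u
  - tder f p (D p u (coord_field p v)).

Definition laplacian g (D : covder) f (p : M) : R :=
  metric_trace (g p) (hessian D f p).

(** The divergence at p computed in a frame e of T_pM. *)
Definition divergence g (D : covder) X p (e : 'I_n -> 'rV[R]_n) : R :=
  \sum_i g p (D p (e i) X) (e i).

End Connections.

Arguments covder {R n} M.

(** * Products of manifolds *)

Lemma near_eq_differentiable {R : realType} {V W : normedModType R}
    (f g : V -> W) (x : V) :
  {near x, f =1 g} -> differentiable f x -> differentiable g x.
Proof.
move=> fg df; apply/diffP => /=.
apply: (@getPex _ (fun (dg : {linear V -> W}) => continuous dg /\
  forall y, g y = g (lim (nbhs x)) + dg (y - lim (nbhs x))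
                  +o_(y \near x) (y - lim (nbhs x)))).
exists ('d f x); split; first exact: diff_continuous.
have /diffP [_ /funext fo] := df.
suff go : g = (fun y => g (lim (nbhs x)) + 'd f x (y - lim (nbhs x)))
   +o_ x (fun y => y - lim (nbhs x)) by move=> y; rewrite {1}go.
apply/eqaddoP => e e0; move/eqaddoP: fo => /(_ e e0) fo.
near=> y.
have -> : (g - (fun y => g (lim (nbhs x)) + 'd f x (y - lim (nbhs x)))) y =
  (f - (fun y => f (lim (nbhs x)) + 'd f x (y - lim (nbhs x)))) y.
  rewrite /GRing.add /GRing.opp /= lim_id // (nbhs_singleton fg).
  by rewrite (near fg y).
by near: y.
Unshelve. all: by end_near. Qed.

Lemma Ck_on_eq {R : realType} {n : nat} (k : nat) (U : set 'rV[R]_n)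
    (f g : 'rV[R]_n -> R) :
  open U -> (forall x, U x -> f x = g x) -> Ck_on k U f -> Ck_on k U g.
Proof.
move=> oU; elim: k f g => [|k IH] f g fg.
  move=> cf x Ux.
  have nfg : {near x, f =1 g}.
    by near=> y; apply: fg; near: y; exact: open_nbhs_nbhs.
  rewrite /prop_for /continuous_at -(fg x Ux).
  by apply: cvg_trans (cf x Ux); exact: near_eq_cvg nfg.
move=> [df pf]; split => [x Ux|i].
  apply: near_eq_differentiable (df x Ux).
  by near=> y; apply: fg; near: y; exact: open_nbhs_nbhs.
have := pf i; apply: IH => x Ux.
apply: near_eq_derive; near=> y; apply: fg; near: y; exact: open_nbhs_nbhs.
Unshelve. all: by end_near. Qed.

Lemma Ck_on_cst {R : realType} {n : nat} (k : nat) (U : set 'rV[R]_n) (c : R) :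
  Ck_on k U (fun=> c).
Proof.
elim: k c => [|k IH] c /=; first by move=> x _; exact: cst_continuous.
split => [x _|i]; first exact: differentiable_cst.
by under eq_fun do rewrite derive_cst; exact: IH.
Qed.

Lemma Ck_on_comp_linear {R : realType} {m n : nat} (k : nat)
    (L : {linear 'rV[R]_m -> 'rV[R]_n})
    (U : set 'rV[R]_n) (V : set 'rV[R]_m) (f : 'rV[R]_n -> R) :
  continuous L -> open V -> V `<=` L @^-1` U ->
  (forall i : 'I_m, L (delta_mx 0 i) = 0 \/
     exists j : 'I_n, L (delta_mx 0 i) = delta_mx 0 j) ->
  Ck_on k U f -> Ck_on k V (f \o L).
Proof.
move=> cL oV VU Li; elim: k f => [|k IH] f.
  by move=> cf x /VU Ux; apply: continuous_comp; [exact: cL|exact: cf].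
move=> [df pf].
have dL x : differentiable L x by exact: linear_differentiable.
have dfL x : V x -> differentiable (f \o L) x.
  by move=> /VU Ux; apply: differentiable_comp => //; exact: df.
split => // i.
have D x : V x -> 'D_(L (delta_mx 0 i)) f (L x) = 'D_(delta_mx 0 i) (f \o L) x.
  move=> Vx; have dfx : differentiable f (L x) by apply: df; exact: VU.
  rewrite (deriveE _ dfx) (deriveE _ (dfL _ Vx)) (diff_comp (dL x) dfx) /=.
  by rewrite diff_lin.
have [L0|[j Lj]] := Li i.
  apply: (Ck_on_eq oV _ (Ck_on_cst k V 0)) => x Vx.
  by rewrite -D// L0 derive0.
apply: (Ck_on_eq oV _ (IH _ (pf j))) => x Vx.
by rewrite -D// Lj.
Qed.

Section Product.
Context {R : realType} {n1 n2 : nat}.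
Variables (B : smoothManifold R n1) (F : smoothManifold R n2).

Definition prod_chart_dom (c : B * F) : set (B * F) :=
  chart_dom c.1 `*` chart_dom c.2.

Definition prod_chart (c x : B * F) : 'rV[R]_(n1 + n2) :=
  row_mx (chart c.1 x.1) (chart c.2 x.2).

Definition prod_chart_inv (c : B * F) (z : 'rV[R]_(n1 + n2)) : B * F :=
  (chart_inv c.1 (lsubmx z), chart_inv c.2 (rsubmx z)).

Lemma open_setX (T1 T2 : topologicalType) (A1 : set T1) (A2 : set T2) :
  open A1 -> open A2 -> open (A1 `*` A2).
Proof.
move=> o1 o2; rewrite openE => -[x y] [/= Ax Ay].
by exists (A1, A2) => //; split; exact: open_nbhs_nbhs.
Qed.

Lemma prod_chart_image (c : B * F) (A1 : set B) (A2 : set F) :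
  prod_chart c @` (A1 `*` A2) =
  [set z | (chart c.1 @` A1) (lsubmx z) /\ (chart c.2 @` A2) (rsubmx z)].
Proof.
apply/seteqP; split => [_ [[x y] [/= Ax Ay] <-]|z /= [[x Ax xz] [y Ay yz]]].
  by rewrite /= row_mxKl row_mxKr; split; [exists x|exists y].
by exists (x, y) => //; rewrite /prod_chart /= xz yz hsubmxK.
Qed.

Lemma open_hsubmx (A1 : set 'rV[R]_n1) (A2 : set 'rV[R]_n2) :
  open A1 -> open A2 -> open [set z | A1 (lsubmx z) /\ A2 (rsubmx z)].
Proof.
move=> o1 o2; apply: (@openI _ (lsubmx @^-1` A1) (rsubmx @^-1` A2)).
  by apply: open_comp => // z _; exact: continuous_lsubmx.
by apply: open_comp => // z _; exact: continuous_rsubmx.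
Qed.

Lemma open_chart_img (n : nat) (M : smoothManifold R n) (p : M) (U : set M) :
  open U -> open (chart p @` (chart_dom p `&` U)).
Proof.
move=> oU; rewrite openE => z [x [px Ux] <-].
have oimg := @chart_img_open _ _ M p.
have img : (chart p @` chart_dom p) (chart p x) by exists x.
have n1' : \forall z \near chart p x, (chart p @` chart_dom p) z.
  exact: open_nbhs_nbhs.
have n2' : \forall z \near chart p x, U (chart_inv p z).
  apply: (chart_inv_continuous img); rewrite chartK//.
  exact: open_nbhs_nbhs.
rewrite /interior; near=> w.
have [y py yw] : (chart p @` chart_dom p) w by near: w.
exists y => //; split => //; rewrite -(chartK py) yw; near: w; exact: n2'.
Unshelve. all: by end_near. Qed.

Lemma prod_hausdorff : hausdorff_space (B * F)%type.
Proof.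
move=> [x1 y1] [x2 y2] cl; congr pair.
  apply: (@carrier_hausdorff _ _ B) => A1 A2 nA1 nA2.
  have [] := cl (A1 `*` setT) (A2 `*` setT).
  - by exists (A1, setT) => //; split => //; exact: filterT.
  - by exists (A2, setT) => //; split => //; exact: filterT.
  by move=> [x y] [[/= ? _] [/= ? _]]; exists x.
apply: (@carrier_hausdorff _ _ F) => A1 A2 nA1 nA2.
have [] := cl (setT `*` A1) (setT `*` A2).
- by exists (setT, A1) => //; split => //; exact: filterT.
- by exists (setT, A2) => //; split => //; exact: filterT.
by move=> [x y] [[/= _ ?] [/= _ ?]]; exists y.
Qed.

Lemma prod_second_countable : @second_countable (B * F)%type.
Proof.
have [BB cB [oB bB]] := @carrier_second_countable _ _ B.
have [BF cF [oF bF]] := @carrier_second_countable _ _ F.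
exists ((fun A => A.1 `*` A.2) @` (BB `*` BF)).
  apply: sub_countable (countableX cB cF); exact: card_image_le.
split => [_ [[A1 A2] [/= A1B A2F] <-]|[x y] A].
  by apply: open_setX; [exact: oB|exact: oF].
move=> [[A1 A2] [/= /bB [U1 [BU1 U1x] UA1] /bF [U2 [BU2 U2y] UA2]] sA].
exists (U1 `*` U2).
  by split => //; exists (U1, U2).
by move=> [a b] [/= Ua Ub]; apply: sA; split => /=; [exact: UA1|exact: UA2].
Qed.

Lemma prod_mem_chart_dom c : prod_chart_dom c c.
Proof. by split; exact: mem_chart_dom. Qed.

Lemma prod_chart_dom_open c : open (prod_chart_dom c).
Proof. by apply: open_setX; exact: chart_dom_open. Qed.

Lemma prod_chart_img_open c : open (prod_chart c @` prod_chart_dom c).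
Proof.
by rewrite prod_chart_image; apply: open_hsubmx; exact: chart_img_open.
Qed.

Lemma prod_chartK c x : prod_chart_dom c x ->
  prod_chart_inv c (prod_chart c x) = x.
Proof.
case: x => x y [/= cx cy].
by rewrite /prod_chart_inv /prod_chart row_mxKl row_mxKr /= !chartK.
Qed.

Lemma continuous_row_mx (u : 'rV[R]_n1 * 'rV[R]_n2) :
  {for u, continuous (fun u : 'rV[R]_n1 * 'rV[R]_n2 => row_mx u.1 u.2)}.
Proof.
move=> A /nbhs_ballP[e /= e0 eA].
apply/nbhs_ballP; exists e => //= v [[_ b1] [_ b2]]; apply: eA; split => // i j.
by case: (split_ordP j) => k ->; rewrite ?row_mxEl ?row_mxEr.
Qed.

Lemma prod_chart_continuous c x : prod_chart_dom c x ->
  {for x, continuous (prod_chart c)}.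
Proof.
move=> [cx cy].
apply: (@continuous_comp _ _ _ (fun x : B * F => (chart c.1 x.1, chart c.2 x.2))
  (fun u : 'rV[R]_n1 * 'rV[R]_n2 => row_mx u.1 u.2)); last exact: continuous_row_mx.
apply: (@cvg_pair _ _ _ _ (nbhs (chart c.1 x.1)) (nbhs (chart c.2 x.2))).
  by apply: (@continuous_comp _ _ _ fst (chart c.1)); [exact: cvg_fst|exact: chart_continuous].
by apply: (@continuous_comp _ _ _ snd (chart c.2)); [exact: cvg_snd|exact: chart_continuous].
Qed.

Lemma prod_chart_inv_continuous c z : (prod_chart c @` prod_chart_dom c) z ->
  {for z, continuous (prod_chart_inv c)}.
Proof.
rewrite prod_chart_image => -[cx cy].
have h1 : {for z, continuous (chart_inv c.1 \o lsubmx)}.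
  by apply: continuous_comp; [exact: continuous_lsubmx|exact: chart_inv_continuous].
have h2 : {for z, continuous (chart_inv c.2 \o rsubmx)}.
  by apply: continuous_comp; [exact: continuous_rsubmx|exact: chart_inv_continuous].
exact: (cvg_pair h1 h2).
Qed.

Lemma prod_chart_compatible c d (j : 'I_(n1 + n2)) :
  Cinfty_on (prod_chart c @` (prod_chart_dom c `&` prod_chart_dom d))
            (fun z => prod_chart d (prod_chart_inv c z) 0 j).
Proof.
have -> : prod_chart_dom c `&` prod_chart_dom d =
    (chart_dom c.1 `&` chart_dom d.1) `*` (chart_dom c.2 `&` chart_dom d.2).
  by apply/seteqP; split => [[x y] [[/= ? ?] [/= ? ?]]|[x y] [/= [? ?] [? ?]]].
rewrite prod_chart_image => k; set V := [set z | _].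
have oV : open V by apply: open_hsubmx; exact/open_chart_img/chart_dom_open.
rewrite /prod_chart /prod_chart_inv /=.
case: (split_ordP j) => i ->.
  have -> : (fun z : 'rV[R]_(n1 + n2) => row_mx (chart d.1 (chart_inv c.1 (lsubmx z)))
       (chart d.2 (chart_inv c.2 (rsubmx z))) 0 (lshift n2 i)) =
     (fun y => chart d.1 (chart_inv c.1 y) 0 i) \o lsubmx.
    by apply/funext => z; rewrite row_mxEl.
  apply: (Ck_on_comp_linear _ oV _ _ (chart_compatible c.1 d.1 i k)).
  - exact: continuous_lsubmx.
  - by move=> z [].
  move=> l; case: (split_ordP l) => m ->; [right; exists m|left];
    by apply/matrixP => a b; rewrite !mxE eq_shift ?andbF.
have -> : (fun z : 'rV[R]_(n1 + n2) => row_mx (chart d.1 (chart_inv c.1 (lsubmx z)))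
     (chart d.2 (chart_inv c.2 (rsubmx z))) 0 (rshift n1 i)) =
   (fun y => chart d.2 (chart_inv c.2 y) 0 i) \o rsubmx.
  by apply/funext => z; rewrite row_mxEr.
apply: (Ck_on_comp_linear _ oV _ _ (chart_compatible c.2 d.2 i k)).
- exact: continuous_rsubmx.
- by move=> z [].
move=> l; case: (split_ordP l) => m ->; [left|right; exists m];
  by apply/matrixP => a b; rewrite !mxE eq_shift ?andbF.
Qed.

Definition prod_manifold : smoothManifold R (n1 + n2) :=
  @SmoothManifold R (n1 + n2) (B * F)%type
    prod_chart_dom prod_chart prod_chart_inv
    prod_hausdorff prod_second_countable
    prod_mem_chart_dom prod_chart_dom_open prod_chart_img_open
    prod_chartK prod_chart_continuous prod_chart_inv_continuous
    prod_chart_compatible.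

End Product.

(** * Doubly warped products *)

(** The chart of the product at [x] is the product of the charts at [x.1] and
    [x.2], so the differentials of the two projections are [lsubmx] and
    [rsubmx], and the lift of a field X on B is [row_mx X 0]. *)
Section DoublyWarped.
Context {R : realType} {n1 n2 : nat}.
Context {B : smoothManifold R n1} {F : smoothManifold R n2}.

Definition dwp_metric (gB : bilin_field B) (gF : bilin_field F)
    (f : F -> R) (h : B -> R) : bilin_field (prod_manifold B F) :=
  fun x u v => f x.2 ^+ 2 * gB x.1 (lsubmx u) (lsubmx v)
             + h x.1 ^+ 2 * gF x.2 (rsubmx u) (rsubmx v).

Definition liftB (X : vfield B) : vfield (prod_manifold B F) :=
  fun x => row_mx (X x.1) 0.

(** The metrics induced by g on the leaves B x {q} and {p} x F. *)
Definition leafB (g : bilin_field (prod_manifold B F)) (q : F) : bilin_field B :=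
  fun p u v => g (p, q) (row_mx u 0) (row_mx v 0).

Definition leafF (g : bilin_field (prod_manifold B F)) (p : B) : bilin_field F :=
  fun q u v => g (p, q) (row_mx 0 u) (row_mx 0 v).

End DoublyWarped.

(* Main.v *)
Require Import Defs.
From HB Require Import structures.
From mathcomp Require Import all_boot all_order all_algebra.
From mathcomp Require Import all_classical all_reals all_analysis.
From mathcomp Require Import ring.

Import Order.TTheory GRing.Theory Num.Theory.
Import numFieldNormedType.Exports.
Local Open Scope classical_set_scope.
Local Open Scope ring_scope.

Set Implicit Arguments.
Unset Strict Implicit.
Unset Printing Implicit Defensive.

(** Three formulas carry the theorem.

    For any Riemannian metric g of dimension n, passing from the Levi-Civita
    connection to the semi-symmetric one associated with P changes the Ricci
    tensor by
      - (n - 2) (nabla P - P (x) P) - (div P + (n - 2) |P|^2) g,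
    indices being lowered with g, hence the scalar curvature by
      - 2 (n - 1) div P - (n - 1) (n - 2) |P|^2
    ([scalar_curvature_semi_symmetric]). It is applied twice: to M with the lift
    of P, and to the leaf B x {q}, whose induced metric f(q)^2 g_B has the same
    Levi-Civita connection as g_B.

    The scalar curvature of the doubly warped metric itself is
      r_B / f^2 + r_F / h^2
      - n1 (n1 - 1) |grad f|^2 / f^2 - n2 (n2 - 1) |grad h|^2 / h^2
      - 2 n1 Delta f / f - 2 n2 Delta h / h
    ([scalar_curvature_dwp]), and on M the divergence of the lift of P exceeds
    that on B by n2 P(h) / h ([divergence_dwp]). Subtracting the two instances
    of the first formula leaves the coefficients 2 (n1 - 1) - 2 (n - 1) = - 2 n2
    of div P and (n1 - 1) (n1 - 2) - (n - 1) (n - 2) = - n2 (n + n1 - 3) of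
    |P|^2.

    Curvature, Hessian and divergence at a point p are defined by the
    coordinate fields of the chart at p, so everything is computed with
    Christoffel symbols there. Torsion-freeness makes them symmetric because
    coordinate fields commute, which rests on the symmetry of second
    derivatives ([derive_comm]); the Koszul formula then expresses those of M by
    those of B and F ([warped_christoffel111], [warped_christoffel121],
    [warped_christoffel112]). The two factors play symmetric roles, so the Ricci
    tensor is computed on one of them only ([warped_ricci11]). *)

(** * Functions of class C^k *)

Section Calculus.
Context {R : realType}.

Lemma Ck_on_sub {n} k (U V : set 'rV[R]_n) (f : 'rV[R]_n -> R) :
  V `<=` U -> Ck_on k U f -> Ck_on k V f.
Proof.
move=> VU; elim: k f => [|k IH] f /=; first by move=> cf x /VU; exact: cf.
by move=> [df pf]; split => [x /VU|i]; [exact: df|exact: IH].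
Qed.

Lemma Ck_onW {n} k (U : set 'rV[R]_n) (f : 'rV[R]_n -> R) :
  Ck_on k.+1 U f -> Ck_on k U f.
Proof.
elim: k f => [|k IH] f [df pf]; last by split=> // i; exact: IH.
by move=> x Ux; exact: differentiable_continuous (df x Ux).
Qed.

Lemma Ck_onD {n} k (U : set 'rV[R]_n) (f g : 'rV[R]_n -> R) : open U ->
  Ck_on k U f -> Ck_on k U g -> Ck_on k U (fun x => f x + g x).
Proof.
move=> oU; elim: k f g => [|k IH] f g.
  by move=> cf cg x Ux; apply: continuousD; [exact: cf|exact: cg].
move=> [df pf] [dg pg]; split=> [x Ux|i].
  by apply: differentiableD; [exact: df|exact: dg].
apply: (Ck_on_eq oU _ (IH _ _ (pf i) (pg i))) => x Ux.
by rewrite -deriveD//; apply: diff_derivable; [exact: df|exact: dg].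
Qed.

Lemma Ck_onM {n} k (U : set 'rV[R]_n) (f g : 'rV[R]_n -> R) : open U ->
  Ck_on k U f -> Ck_on k U g -> Ck_on k U (fun x => f x * g x).
Proof.
move=> oU; elim: k f g => [|k IH] f g.
  by move=> cf cg x Ux; apply: continuousM; [exact: cf|exact: cg].
move=> cf cg; have [df pf] := cf; have [dg pg] := cg; split=> [x Ux|i].
  by apply: differentiableM; [exact: df|exact: dg].
have cfi := IH _ _ (Ck_onW cf) (pg i); have cgi := IH _ _ (Ck_onW cg) (pf i).
apply: (Ck_on_eq oU _ (Ck_onD oU cfi cgi)) => x Ux.
by rewrite -deriveM//; apply: diff_derivable; [exact: df|exact: dg].
Qed.

Lemma Ck_on_sum {n} k (U : set 'rV[R]_n) m (f : 'I_m -> 'rV[R]_n -> R) :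
  open U -> (forall i, Ck_on k U (f i)) -> Ck_on k U (fun x => \sum_i f i x).
Proof.
move=> oU; elim: m f => [|m IH] f cf.
  by under eq_fun do rewrite big_ord0; exact: Ck_on_cst.
under eq_fun do rewrite big_ord_recl.
by apply: Ck_onD => //; exact: IH.
Qed.

Lemma Ck_on_local {n} k (U : set 'rV[R]_n) (f : 'rV[R]_n -> R) :
  (forall x, U x -> exists2 V, V x & Ck_on k V f) -> Ck_on k U f.
Proof.
elim: k f => [|k IH] f lf; first by move=> x /lf[V Vx]; exact.
split=> [x /lf[V Vx [df _]]|i]; first exact: df.
by apply: IH => x /lf[V Vx [_ pf]]; exists V => //; exact: pf.
Qed.

Lemma differentiable_rV {V : normedModType R} {n} (f : V -> 'rV[R]_n) x :
  (forall j, differentiable (fun y => f y 0 j) x) -> differentiable f x.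
Proof.
move=> df.
have -> : f = \sum_j (fun y => f y 0 j *: delta_mx 0 j).
  by apply/funext => y; rewrite fct_sumE; exact: row_sum_delta.
by apply: differentiable_sum => j; apply: differentiableZl; exact: df.
Qed.

Lemma derive_coord {V : normedModType R} {n} (f : V -> 'rV[R]_n) x v j :
  differentiable f x -> ('D_v f x) 0 j = 'D_v (fun y => f y 0 j) x.
Proof. by move=> df; rewrite derive_mx ?mxE//; exact: diff_derivable. Qed.

Lemma derive_partials {n} (f : 'rV[R]_n -> R) x v : differentiable f x ->
  'D_v f x = \sum_i v 0 i * 'D_(delta_mx 0 i) f x.
Proof.
move=> df; rewrite deriveE// {1}(row_sum_delta v) linear_sum /=.
by apply: eq_bigr => i _; rewrite linearZ /= deriveE.
Qed.

Lemma derive_comp {V : normedModType R} {n} (f : 'rV[R]_n -> R)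
    (u : V -> 'rV[R]_n) x v :
  differentiable u x -> differentiable f (u x) ->
  'D_v (f \o u) x = 'D_('D_v u x) f (u x).
Proof.
move=> du df; rewrite !deriveE//; last exact: differentiable_comp.
by rewrite diff_comp.
Qed.

(** The partial derivatives of a composite are sums of products of derivatives
    of u, of class C^k, with partial derivatives of f composed with u, to which
    the induction hypothesis applies. *)
Lemma Ck_on_comp {m n} k (U : set 'rV[R]_n) (V : set 'rV[R]_m)
    (f : 'rV[R]_n -> R) (u : 'rV[R]_m -> 'rV[R]_n) :
  open V -> V `<=` u @^-1` U -> (forall j, Ck_on k.+1 V (fun x => u x 0 j)) ->
  Ck_on k U f -> Ck_on k V (f \o u).
Proof.
move=> oV VU; elim: k f => [|k IH] f cu.
  move=> cf x Vx; apply: continuous_comp; last exact: cf (VU _ Vx).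
  apply: differentiable_continuous; apply: differentiable_rV => j.
  by have [+ _] := cu j; exact.
move=> [df pf].
have du x : V x -> differentiable u x.
  by move=> Vx; apply: differentiable_rV => j; have [+ _] := cu j; exact.
split=> [x Vx|i].
  by apply: differentiable_comp; [exact: du|exact: df (VU _ Vx)].
have cfu j : Ck_on k V (('D_(delta_mx 0 j) f) \o u).
  by apply: IH (pf j) => l; exact: Ck_onW (cu l).
have cui j : Ck_on k V (fun x => 'D_(delta_mx 0 i) (fun y => u y 0 j) x).
  by have [_ /(_ i)] := cu j; exact: Ck_onW.
apply: (Ck_on_eq oV _ (Ck_on_sum oV (fun j => Ck_onM oV (cui j) (cfu j)))).
move=> x Vx; rewrite derive_comp; [|exact: du|exact: df (VU _ Vx)].
rewrite derive_partials; last exact: df (VU _ Vx).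
by apply: eq_bigr => j _; rewrite derive_coord//; exact: du.
Qed.

End Calculus.

(** * Symmetry of second derivatives *)

Section Schwarz.
Context {R : realType} {V : normedModType R}.
Implicit Types (f : V -> R) (u v x y : V).

Lemma is_derive_line f u y (a : R) : differentiable f (a *: u + y) ->
  is_derive a 1 (fun b => f (b *: u + y)) ('D_u f (a *: u + y)).
Proof.
move=> df; set l := fun b : R => b *: u + y.
have dl : is_diff a l (fun b => b *: u).
  rewrite (_ : (fun b => b *: u) = (fun b => b *: u) + 0); last by rewrite addr0.
  exact: is_diffD.
have dfl : differentiable (f \o l) a by apply: differentiable_comp.
apply: DeriveDef; first exact: diff_derivable.
rewrite deriveE// diff_comp//= diff_val scale1r.
by rewrite deriveE.
Qed.

Lemma MVT_line f u y (s : R) : 0 <= s ->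
  (forall a, a \in `[0, s] -> differentiable f (a *: u + y)) ->
  exists2 a, a \in `[0, s] & f (s *: u + y) - f y = 'D_u f (a *: u + y) * s.
Proof.
move=> s0 df.
have dl a : a \in `[0, s] -> is_derive a 1 (fun b => f (b *: u + y))
  ('D_u f (a *: u + y)) by move=> /df; exact: is_derive_line.
have cl : {within `[0, s], continuous (fun b => f (b *: u + y))}.
  apply: continuous_in_subspaceT => a; rewrite inE /= => /dl ?.
  exact/differentiable_continuous/derivable1_diffP.
have [a ai] := MVT_segment s0 (fun a ai => dl a (subset_itv_oo_cc ai)) cl.
by rewrite scale0r add0r subr0 => E; exists a.
Qed.

Lemma is_diff_translate f w y : differentiable f (w + y) ->
  differentiable (fun z => f (w + z)) y /\
  forall u, 'D_u (fun z => f (w + z)) y = 'D_u f (w + y).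
Proof.
move=> df; have dl : is_diff y (fun z => w + z) id.
  rewrite (_ : id = 0 + id); last by rewrite add0r.
  exact: is_diffD.
have dfl : differentiable (f \o (fun z => w + z)) y.
  exact: differentiable_comp.
split => // u; rewrite !deriveE// (_ : (fun z => _) = f \o (fun z => w + z))//.
by rewrite diff_comp//= diff_val.
Qed.

(** Two applications of the mean value theorem: first to the increment of f
    along v, as a function on a segment directed by u, then to the derivative
    of f along u, on a segment directed by v. *)
Lemma second_difference f u v x (s : R) : 0 <= s ->
  (forall a b, a \in `[0, s] -> b \in `[0, s] ->
    differentiable f (a *: u + (b *: v + x)) /\
    differentiable ('D_u f) (a *: u + (b *: v + x))) ->
  exists a b, [/\ a \in `[0, s], b \in `[0, s] &
    f (s *: u + (s *: v + x)) - f (s *: u + x) - (f (s *: v + x) - f x) =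
    'D_v ('D_u f) (a *: u + (b *: v + x)) * s ^+ 2].
Proof.
move=> s0 df.
have i0 : 0 \in `[0, s] by rewrite in_itv /= lexx.
have is_ : s \in `[0, s] by rewrite in_itv /= lexx s0.
pose g y := f (s *: v + y) - f y.
have dg a : a \in `[0, s] -> differentiable g (a *: u + x) /\
    'D_u g (a *: u + x) = 'D_u f (s *: v + (a *: u + x)) - 'D_u f (a *: u + x).
  move=> ai; have [d1 _] := df _ _ ai is_; have [d2 _] := df _ _ ai i0.
  rewrite scale0r add0r in d2; rewrite addrCA in d1.
  have [d3 e3] := is_diff_translate d1; split; first exact: differentiableB.
  by rewrite deriveB ?e3//; exact: diff_derivable.
have [a ai] := MVT_line s0 (fun a ai => (dg a ai).1).
rewrite (dg a ai).2 => Eg.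
have [b bi Eb] := @MVT_line ('D_u f) v (a *: u + x) s s0 (fun b bi =>
  let: d := (df a b ai bi).2 in
  ltac:(rewrite addrCA; exact: d)).
exists a, b; split => //; rewrite (addrCA (a *: u)) expr2 mulrA -Eb -Eg /g.
by rewrite (addrCA (s *: v)).
Qed.

(** The second difference of f is symmetric in u and v, and it is the value of
    either iterated derivative at a point near x, times s^2. *)
Lemma derive_comm f u v x :
  (\forall y \near x, [/\ differentiable f y, differentiable ('D_u f) y &
     differentiable ('D_v f) y]) ->
  {for x, continuous ('D_v ('D_u f))} -> {for x, continuous ('D_u ('D_v f))} ->
  'D_v ('D_u f) x = 'D_u ('D_v f) x.
Proof.
move=> df cu cv; apply/eqP; rewrite -subr_eq0 -normr_le0.
apply/ler_addgt0Pl => e e0; rewrite addr0.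
have e20 : 0 < e / 2 by rewrite divr_gt0.
have nu : \forall y \near x, `|'D_v ('D_u f) x - 'D_v ('D_u f) y| < e / 2.
  exact: ((@cvgrPdist_lt _ _ _ _ _ _ _).1 cu _ e20).
have nv : \forall y \near x, `|'D_u ('D_v f) x - 'D_u ('D_v f) y| < e / 2.
  exact: ((@cvgrPdist_lt _ _ _ _ _ _ _).1 cv _ e20).
have := @filterI _ _ (nbhs_filter x) _ _ df (@filterI _ _ (nbhs_filter x) _ _ nu nv); set A := (X in nbhs x X) => nA.
have [s s0 sA] : exists2 s : R, 0 < s & forall a b, a \in `[0, s] ->
    b \in `[0, s] -> A (a *: u + (b *: v + x)).
  have [d /= d0 dA] : exists2 d : R, 0 < d & ball x d `<=` A.
    by have /(_ nA)[d] := (nbhs_ballP x A).1; exists d.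
  pose N := `|u| + `|v| + 1.
  have N0 : 0 < N by rewrite ltr_wpDl// addr_ge0.
  exists (d / 2 / N); first by rewrite !divr_gt0.
  move=> a b; rewrite !in_itv /= => /andP[a0 al] /andP[b0 bl]; apply: dA.
  rewrite -ball_normE /= addrA opprD addrCA subrr addr0 normrN.
  apply: le_lt_trans (ler_normD _ _) _; rewrite !normrZ !ger0_norm//.
  have : a * `|u| + b * `|v| <= d / 2 / N * N.
    apply: (@le_trans _ _ (d / 2 / N * `|u| + d / 2 / N * `|v|)).
      by apply: lerD; apply: ler_wpM2r.
    by rewrite -mulrDr; apply: ler_wpM2l; [rewrite ltW// !divr_gt0|rewrite lerDl].
  rewrite divfK ?gt_eqF// => /le_lt_trans; apply.
  by rewrite ltr_pdivrMr// mulr_natr mulr2n ltrDl.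
have [a [b [ai bi E1]]] := @second_difference f u v x s (ltW s0)
  (fun a b ai bi => let: And3 d1 d2 _ := (sA a b ai bi).1 in conj d1 d2).
have [c [d [ci di E2]]] := @second_difference f v u x s (ltW s0)
  (fun a b ai bi => ltac:(rewrite addrCA;
     case: (sA b a bi ai) => -[d1 _ d3] _; exact: conj d1 d3)).
have [_ [Au _]] := sA a b ai bi.
have [_ [_ Av]] := sA d c di ci; rewrite addrCA in Av.
move: E1 E2 Au Av.
set r1 := 'D_v ('D_u f) (a *: u + _); set r2 := 'D_u ('D_v f) (c *: v + _).
move: r1 r2 ('D_v ('D_u f) x) ('D_u ('D_v f) x) => r1 r2 r3 r4.
rewrite (addrCA (s *: v)) => E1 E2.
have -> : r1 = r2.
  by apply: (mulIf (lt0r_neq0 (exprn_gt0 2 s0))); rewrite -E1 -E2; ring.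
move=> /ltW r32 /ltW r42; rewrite (le_trans (ler_distD r2 _ _))// (splitr e).
by rewrite lerD// distrC.
Qed.

End Schwarz.

Lemma partial_comm {R : realType} {n} (U : set 'rV[R]_n) (f : 'rV[R]_n -> R)
    x (i j : 'I_n) : open U -> U x -> Cinfty_on U f ->
  'D_(delta_mx 0 i) ('D_(delta_mx 0 j) f) x =
  'D_(delta_mx 0 j) ('D_(delta_mx 0 i) f) x.
Proof.
move=> oU Ux /(_ 2%N) [df pf]; apply: derive_comm.
- have : nbhs x U by apply: open_nbhs_nbhs.
  apply: filterS => y Uy; split; [exact: df| |].
    by have [+ _] := pf j; exact.
  by have [+ _] := pf i; exact.
- by have [_ /(_ i)] := pf j; apply.
- by have [_ /(_ j)] := pf i; apply.
Qed.

(** * Smooth functions, coordinate frames and vector fields *)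

Section SmoothFunctions.
Context {R : realType} {n : nat} {M : smoothManifold R n}.
Implicit Types (c p x : M) (U V : set M) (f g : M -> R) (v w : 'rV[R]_n).

Lemma open_chart_imgI c U : open U -> open (chart c @` (U `&` chart_dom c)).
Proof. by rewrite setIC; exact: open_chart_img. Qed.

Lemma smooth_fun_sub U V f : V `<=` U -> smooth_fun_on U f -> smooth_fun_on V f.
Proof.
move=> VU sf c k; apply: Ck_on_sub (sf c k).
by apply: image_subset => x [/VU].
Qed.

Lemma smooth_fun_eq U f g : open U -> (forall x, U x -> f x = g x) ->
  smooth_fun_on U f -> smooth_fun_on U g.
Proof.
move=> oU fg sf c k; apply: (Ck_on_eq (open_chart_imgI oU) _ (sf c k)).
by move=> _ [x [Ux cx] <-]; rewrite /= chartK// fg.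
Qed.

Lemma smooth_fun_cst U (a : R) : smooth_fun_on U (fun=> a).
Proof. by move=> c k; exact: Ck_on_cst. Qed.

Lemma smooth_funD U f g : open U -> smooth_fun_on U f -> smooth_fun_on U g ->
  smooth_fun_on U (fun x => f x + g x).
Proof.
move=> oU sf sg c k.
exact: Ck_onD (open_chart_imgI oU) (sf c k) (sg c k).
Qed.

Lemma smooth_funM U f g : open U -> smooth_fun_on U f -> smooth_fun_on U g ->
  smooth_fun_on U (fun x => f x * g x).
Proof.
move=> oU sf sg c k.
exact: Ck_onM (open_chart_imgI oU) (sf c k) (sg c k).
Qed.

Lemma smooth_fun_sum U m (f : 'I_m -> M -> R) : open U ->
  (forall i, smooth_fun_on U (f i)) -> smooth_fun_on U (fun x => \sum_i f i x).
Proof.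
move=> oU sf c k.
exact: Ck_on_sum (open_chart_imgI oU) (fun i => sf i c k).
Qed.

Lemma smooth_fun_local U f :
  (forall x, U x -> exists2 V, V x & smooth_fun_on V f) -> smooth_fun_on U f.
Proof.
move=> lf c k; apply: Ck_on_local => _ [x [Ux cx] <-].
have [V Vx sf] := lf x Ux; exists (chart c @` (V `&` chart_dom c)).
  by exists x.
exact: sf.
Qed.

(** Smoothness may be tested in a single chart, because transition maps are
    smooth. *)
Lemma smooth_fun_in_chart c U f : open U -> U `<=` chart_dom c ->
  Cinfty_on (chart c @` U) (f \o chart_inv c) -> smooth_fun_on U f.
Proof.
move=> oU Uc sf d k.
have oUd := @open_chart_imgI d U oU.
apply: (@Ck_on_eq _ _ _ _
  ((f \o chart_inv c) \o (fun z => chart c (chart_inv d z)))) => //.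
  by move=> _ [x [Ux dx] <-]; rewrite /= chartK// chartK//; exact: Uc.
apply: Ck_on_comp (sf k) => //.
  by move=> _ [x [Ux dx] <-]; rewrite /= chartK//; exists x.
move=> j; apply: Ck_on_sub (chart_compatible d c j k.+1).
by apply: image_subset => x [/Uc].
Qed.

Lemma smooth_chart c k : smooth_fun_on (chart_dom c) (fun x => chart c x 0 k).
Proof. by move=> d; rewrite setIC; exact: chart_compatible. Qed.

Lemma smooth_differentiable c U f x : U x -> chart_dom c x ->
  smooth_fun_on U f -> differentiable (f \o chart_inv c) (chart c x).
Proof. by move=> Ux cx /(_ c 1%N) [df _]; apply: df; exists x. Qed.

Lemma near_chart c x (A : set M) : chart_dom c x -> nbhs x A ->
  \forall z \near chart c x, A (chart_inv c z).
Proof.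
move=> cx nA; have cz : (chart c @` chart_dom c) (chart c x) by exists x.
by have := chart_inv_continuous cz; rewrite /prop_for /continuous_at chartK//; apply.
Qed.

Lemma near_open U x : open U -> U x -> nbhs x U.
Proof. by move=> *; exact: open_nbhs_nbhs. Qed.

Lemma tder_near U f g x v : open U -> U x -> (forall y, U y -> f y = g y) ->
  tder f x v = tder g x v.
Proof.
move=> oU Ux fg; apply: near_eq_derive.
have := near_chart (mem_chart_dom x) (near_open oU Ux).
by apply: filterS => z; exact: fg.
Qed.

Lemma tder_cst x v (a : R) : tder (fun=> a) x v = 0.
Proof. exact: derive_cst. Qed.

Lemma tder0 f x : tder f x 0 = 0.
Proof. exact: derive0. Qed.

Section AtPoint.
Variables (U : set M) (x : M) (Ux : U x).

Lemma smooth_derivable f v : smooth_fun_on U f ->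
  derivable (f \o chart_inv x) (chart x x) v.
Proof.
move=> sf; apply: diff_derivable.
exact: smooth_differentiable Ux (mem_chart_dom x) sf.
Qed.

Lemma tderD f g v : smooth_fun_on U f -> smooth_fun_on U g ->
  tder (fun y => f y + g y) x v = tder f x v + tder g x v.
Proof. by move=> sf sg; rewrite -deriveD//; exact: smooth_derivable. Qed.

Lemma tderM f g v : smooth_fun_on U f -> smooth_fun_on U g ->
  tder (fun y => f y * g y) x v = f x * tder g x v + g x * tder f x v.
Proof.
move=> sf sg; have := @deriveM _ _ _ _ (chart x x) v (smooth_derivable (v := v) sf)
  (smooth_derivable (v := v) sg).
by rewrite /= chartK//; exact: mem_chart_dom.
Qed.

Lemma tder_sum m (f : 'I_m -> M -> R) v : (forall i, smooth_fun_on U (f i)) ->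
  tder (fun y => \sum_i f i y) x v = \sum_i tder (f i) x v.
Proof.
move=> sf; rewrite -derive_sum; last by move=> i; exact: smooth_derivable.
by rewrite /tder; congr ('D_v _ _); apply/funext => z; rewrite fct_sumE.
Qed.

Lemma tder_linear f a v w : smooth_fun_on U f ->
  tder f x (a *: v + w) = a * tder f x v + tder f x w.
Proof.
move=> /(smooth_differentiable Ux (mem_chart_dom x)) df.
by rewrite /tder !deriveE// linearP.
Qed.

Lemma tder_suml f m (v : 'I_m -> 'rV[R]_n) : smooth_fun_on U f ->
  tder f x (\sum_i v i) = \sum_i tder f x (v i).
Proof.
move=> /(smooth_differentiable Ux (mem_chart_dom x)) df.
rewrite /tder !deriveE// linear_sum.
by apply: eq_bigr => i _; rewrite deriveE.
Qed.

Lemma tderZl f a v : smooth_fun_on U f -> tder f x (a *: v) = a * tder f x v.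
Proof.
by move=> sf; rewrite -[a *: v]addr0 tder_linear// (tder0 f x) addr0.
Qed.

End AtPoint.

Lemma differentiable_transition c d x : chart_dom c x -> chart_dom d x ->
  differentiable (chart d \o chart_inv c) (chart c x).
Proof.
move=> cx dx; apply: differentiable_rV => j.
exact: (smooth_differentiable dx cx (@smooth_chart d j)).
Qed.

(** The chain rule for the transition between the charts at [x] and at [p]. *)
Lemma tder_coord p U f x v : open U -> U x -> chart_dom p x ->
  smooth_fun_on U f ->
  tder f x (coord_field p v x) = 'D_v (f \o chart_inv p) (chart p x).
Proof.
move=> oU Ux px sf; have xx := mem_chart_dom x.
have dt := differentiable_transition px xx.
have df := smooth_differentiable Ux xx sf.
rewrite /tder /coord_field.
have := @derive_comp _ _ _ (f \o chart_inv x) (chart x \o chart_inv p)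
  (chart p x) v dt; rewrite /= chartK// => <-//.
apply: near_eq_derive.
have := near_chart px (near_open (@chart_dom_open _ _ _ x) xx).
by apply: filterS => z xz /=; rewrite chartK.
Qed.

Lemma chart_inv_img p x : chart_dom p x -> (chart p @` chart_dom p) (chart p x).
Proof. by exists x. Qed.

Lemma near_chartK p x : chart_dom p x ->
  \forall z \near chart p x, chart p (chart_inv p z) = z.
Proof.
move=> px; have := open_nbhs_nbhs (conj (@chart_img_open _ _ _ p) (chart_inv_img px)).
by apply: filterS => _ [y py <-] /=; rewrite chartK.
Qed.

Lemma coord_field_center p v : coord_field p v p = v.
Proof.
rewrite /coord_field -[RHS](derive_id (chart p p) v).
apply: near_eq_derive; exact: near_chartK (mem_chart_dom p).
Qed.

Lemma tder_chart_coord p x k i : chart_dom p x ->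
  tder (fun y => chart p y 0 k) x (coord_field p (delta_mx 0 i) x) = (k == i)%:R.
Proof.
move=> px; rewrite (tder_coord _ (@chart_dom_open _ _ _ p) px px (@smooth_chart _ k)).
transitivity ('D_(delta_mx 0 i) (fun z : 'rV[R]_n => z 0 k) (chart p x)).
  apply: near_eq_derive; have := near_chartK px.
  by apply: filterS => z /= ->.
rewrite -(derive_coord (f := id))//.
by rewrite derive_id mxE eqxx.
Qed.

(** The differentials of the two transition maps between the charts at p and at
    x are inverse to each other. *)
Lemma frame_expansion p x w : chart_dom p x ->
  w = \sum_k tder (fun y => chart p y 0 k) x w *: coord_field p (delta_mx 0 k) x.
Proof.
move=> px; have xx := mem_chart_dom x.
have d1 := differentiable_transition px xx.
have d2 := differentiable_transition xx px.
have E : 'd (chart x \o chart_inv p) (chart p x)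
           ('d (chart p \o chart_inv x) (chart x x) w) = w.
  have d1' : differentiable (chart x \o chart_inv p)
      ((chart p \o chart_inv x) (chart x x)) by rewrite /= chartK.
  have := diff_comp d2 d1' => /(congr1 (fun l : _ -> _ => l w)) /=.
  rewrite chartK// => <-; rewrite -deriveE; last exact: differentiable_comp.
  rewrite -[RHS](derive_id (chart x x) w); apply: near_eq_derive.
  have := @filterI _ _ (nbhs_filter _) _ _ (near_chartK xx)
    (near_chart xx (near_open (@chart_dom_open _ _ _ p) px)).
  by apply: filterS => z [xz pz] /=; rewrite chartK.
rewrite -[LHS]E [X in 'd _ _ X](row_sum_delta _) linear_sum.
apply: eq_bigr => k _; rewrite linearZ /= /coord_field deriveE//; congr (_ *: _).
by rewrite -deriveE// derive_coord.
Qed.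

Lemma smooth_partial p U f i : open U -> U `<=` chart_dom p ->
  smooth_fun_on U f ->
  smooth_fun_on U (fun y => tder f y (coord_field p (delta_mx 0 i) y)).
Proof.
move=> oU Up sf; have oV : open (chart p @` U).
  by rewrite -(setIidl Up); exact: open_chart_imgI.
apply: (smooth_fun_in_chart oU Up) => k.
apply: (@Ck_on_eq _ _ _ _ ('D_(delta_mx 0 i) (f \o chart_inv p))) => //.
  move=> _ [x Ux <-] /=; rewrite chartK; last exact: Up.
  by rewrite (tder_coord _ oU Ux (Up _ Ux) sf).
by have [_] := sf p k.+1; rewrite setIidl//; apply.
Qed.

Lemma smooth_coord_field p i :
  smooth_vfield_on (chart_dom p) (coord_field p (delta_mx 0 i)).
Proof. by move=> V f oV Vp; exact: smooth_partial. Qed.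

Lemma tder_coord2 p U f x i j : open U -> U x -> chart_dom p x ->
  smooth_fun_on U f ->
  tder (fun y => tder f y (coord_field p (delta_mx 0 j) y)) x
    (coord_field p (delta_mx 0 i) x) =
  'D_(delta_mx 0 i) ('D_(delta_mx 0 j) (f \o chart_inv p)) (chart p x).
Proof.
move=> oU Ux px sf; pose V := U `&` chart_dom p.
have oV : open V by apply: openI => //; exact: chart_dom_open.
have VU : V `<=` U by move=> y [].
have Vp : V `<=` chart_dom p by move=> y [].
have sfi := smooth_partial j oV Vp (smooth_fun_sub VU sf).
rewrite (tder_coord _ oV (conj Ux px) px sfi); apply: near_eq_derive.
have := @filterI _ _ (nbhs_filter _) _ _ (near_chartK px)
  (near_chart px (near_open oV (conj Ux px))).
apply: filterS => z [Ez [Uz pz]] /=.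
by rewrite (tder_coord _ oU Uz pz sf) Ez.
Qed.

(** Both sides are second partial derivatives in the chart at p. *)
Lemma tder_comm p U f x i j : open U -> U x -> chart_dom p x ->
  smooth_fun_on U f ->
  tder (fun y => tder f y (coord_field p (delta_mx 0 j) y)) x
    (coord_field p (delta_mx 0 i) x) =
  tder (fun y => tder f y (coord_field p (delta_mx 0 i) y)) x
    (coord_field p (delta_mx 0 j) x).
Proof.
move=> oU Ux px sf; have E a b := @tder_coord2 p U f x a b oU Ux px sf.
apply: (etrans (E i j)); apply: etrans _ (esym (E j i)).
have Vx : (chart p @` (U `&` chart_dom p)) (chart p x) by exists x.
exact: partial_comm (@open_chart_imgI p U oU) Vx (sf p).
Qed.

Lemma bracket_coord p x i j : chart_dom p x ->
  bracket (coord_field p (delta_mx 0 i)) (coord_field p (delta_mx 0 j)) x = 0.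
Proof.
move=> px; apply/rowP => k; rewrite !mxE; apply/eqP; rewrite subr_eq0; apply/eqP.
exact: tder_comm (@chart_dom_open _ _ _ x) (mem_chart_dom x) px (@smooth_chart _ k).
Qed.

Implicit Types X Y : vfield M.

Lemma smooth_vfield_sub U V X : V `<=` U -> smooth_vfield_on U X ->
  smooth_vfield_on V X.
Proof. by move=> VU sX W f oW WV; apply: sX => // y /WV/VU. Qed.

Lemma smooth_vfieldD U X Y : smooth_vfield_on U X -> smooth_vfield_on U Y ->
  smooth_vfield_on U (fun x => X x + Y x).
Proof.
move=> sX sY V f oV VU sf.
have := smooth_funD oV (sX V f oV VU sf) (sY V f oV VU sf).
apply: smooth_fun_eq => // x Vx; rewrite -[X x]scale1r (tder_linear Vx)//.
by rewrite mul1r scale1r.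
Qed.

Lemma smooth_vfieldZ U f X : smooth_fun_on U f -> smooth_vfield_on U X ->
  smooth_vfield_on U (fun x => f x *: X x).
Proof.
move=> sf sX V g oV VU sg.
have := smooth_funM oV (smooth_fun_sub VU sf) (sX V g oV VU sg).
by apply: smooth_fun_eq => // x Vx; rewrite (tderZl Vx).
Qed.

Lemma smooth_vfield0 U : smooth_vfield_on U (fun=> 0).
Proof.
move=> V f oV VU sf; apply: (@smooth_fun_eq _ (fun=> 0)) => //.
  by move=> x _; rewrite tder0.
exact: smooth_fun_cst.
Qed.

Lemma smooth_vfield_sum U m (X : 'I_m -> vfield M) :
  (forall i, smooth_vfield_on U (X i)) ->
  smooth_vfield_on U (fun x => \sum_i X i x).
Proof.
elim: m X => [|m IH] X sX.
  by under eq_fun do rewrite big_ord0; exact: smooth_vfield0.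
by under eq_fun do rewrite big_ord_recl; apply: smooth_vfieldD => //; exact: IH.
Qed.

Lemma smooth_vfield_eq U X Y : (forall x, U x -> X x = Y x) ->
  smooth_vfield_on U X -> smooth_vfield_on U Y.
Proof.
move=> XY sX V f oV VU sf; apply: smooth_fun_eq (sX V f oV VU sf) => // x Vx.
by rewrite XY//; exact: VU.
Qed.

Lemma smooth_components p U X k : open U -> U `<=` chart_dom p ->
  smooth_vfield_on U X ->
  smooth_fun_on U (fun x => tder (fun y => chart p y 0 k) x (X x)).
Proof.
by move=> oU Up sX; apply: sX => //; apply: smooth_fun_sub (@smooth_chart _ k).
Qed.

End SmoothFunctions.

(** * Connections and metrics in coordinates *)

(** By the symmetry of c, the symbols with lower indices i, k cancel, and so do
    those with lower indices j, k. *)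
Lemma koszul_sum {R : realType} {n : nat} (c : 'I_n -> 'I_n -> 'I_n -> R)
    (g : 'I_n -> 'I_n -> R) i j k :
  (forall i j l, c i j l = c j i l) -> (forall i j, g i j = g j i) ->
  2 * (\sum_l c i j l * g l k) =
  (\sum_l c i j l * g l k + \sum_l c i k l * g j l)
  + (\sum_l c j i l * g l k + \sum_l c j k l * g i l)
  - (\sum_l c k i l * g l j + \sum_l c k j l * g i l).
Proof.
move=> cC gC.
rewrite mulr_sumr -!big_split -sumrB /=; apply: eq_bigr => l _.
by rewrite (cC j i) (cC k i) (cC k j) (gC j l); ring.
Qed.

(** Locked, like the next two definitions: they unfold to limits, which
    unification should never compare. *)
HB.lock Definition frame {R : realType} {n : nat} {M : smoothManifold R n}
  (p : M) (i : 'I_n) : vfield M := coord_field p (delta_mx 0 i).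

HB.lock Definition coframe {R : realType} {n : nat} {M : smoothManifold R n}
  (p : M) (k : 'I_n) (x : M) (v : 'rV[R]_n) : R :=
  tder (fun y => chart p y 0 k) x v.

HB.lock Definition partial {R : realType} {n : nat} {M : smoothManifold R n}
  (p : M) (i : 'I_n) (f : M -> R) (x : M) : R := tder f x (frame p i x).

Section Frame.
Context {R : realType} {n : nat} {M : smoothManifold R n}.
Implicit Types (p x : M) (U V : set M) (f g : M -> R) (v w : 'rV[R]_n).
Implicit Types X Y Z : vfield M.

Lemma coframeD p k x v w a : chart_dom p x ->
  coframe p k x (a *: v + w) = a * coframe p k x v + coframe p k x w.
Proof. by move=> px; rewrite coframe.unlock (tder_linear px)//; exact: smooth_chart. Qed.

Lemma coframe_sum p k x m (a : 'I_m -> R) (v : 'I_m -> 'rV[R]_n) : chart_dom p x ->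
  coframe p k x (\sum_i a i *: v i) = \sum_i a i * coframe p k x (v i).
Proof.
move=> px; rewrite coframe.unlock (tder_suml px); last exact: smooth_chart.
by apply: eq_bigr => i _; rewrite (tderZl px)//; exact: smooth_chart.
Qed.

Lemma coframe_frame p x k i : chart_dom p x ->
  coframe p k x (frame p i x) = (k == i)%:R.
Proof. by rewrite coframe.unlock frame.unlock; exact: tder_chart_coord. Qed.

Lemma coframe0 p x k : coframe p k x 0 = 0.
Proof. by rewrite coframe.unlock tder0. Qed.

Lemma frame_center p i : frame p i p = delta_mx 0 i.
Proof. by rewrite frame.unlock coord_field_center. Qed.

Lemma frame_decomposition p x w : chart_dom p x ->
  w = \sum_k coframe p k x w *: frame p k x.
Proof.
by move=> px; rewrite coframe.unlock frame.unlock; exact: frame_expansion.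
Qed.

Lemma coframe_center p k v : coframe p k p v = v 0 k.
Proof.
rewrite [in RHS](frame_decomposition v (mem_chart_dom p)) summxE (bigD1 k)//=.
rewrite big1 ?addr0 ?frame_center ?mxE ?eqxx ?mulr1// => i ik.
by rewrite frame_center !mxE [k == i]eq_sym (negPf ik) andbF mulr0.
Qed.

Lemma smooth_frame p i : smooth_vfield_on (chart_dom p) (frame p i).
Proof. by rewrite frame.unlock; exact: smooth_coord_field. Qed.

Lemma smooth_frame_sub p U i : U `<=` chart_dom p ->
  smooth_vfield_on U (frame p i).
Proof. by move=> Up; exact: smooth_vfield_sub Up (@smooth_frame p i). Qed.

Lemma bracket_frame p x i j : chart_dom p x ->
  bracket (frame p i) (frame p j) x = 0.
Proof. by rewrite frame.unlock; exact: bracket_coord. Qed.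

Lemma smooth_coframe p U X k : open U -> U `<=` chart_dom p ->
  smooth_vfield_on U X -> smooth_fun_on U (fun x => coframe p k x (X x)).
Proof. by rewrite coframe.unlock; exact: smooth_components. Qed.

Lemma partial_center p f i : partial p i f p = tder f p (delta_mx 0 i).
Proof. by rewrite partial.unlock frame_center. Qed.

Lemma tder_partial p U f x (a : 'I_n -> R) : U x -> smooth_fun_on U f ->
  tder f x (\sum_i a i *: frame p i x) = \sum_i a i * partial p i f x.
Proof.
move=> Ux sf; rewrite (tder_suml Ux)// partial.unlock.
by apply: eq_bigr => i _; rewrite (tderZl Ux).
Qed.

Lemma partial_near p U f g x i : open U -> U x -> (forall y, U y -> f y = g y) ->
  partial p i f x = partial p i g x.
Proof. by move=> oU Ux fg; rewrite partial.unlock; exact: tder_near oU Ux fg. Qed.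

Lemma partial_cst p x i (a : R) : partial p i (fun=> a) x = 0.
Proof. by rewrite partial.unlock tder_cst. Qed.

Lemma partialD p U f g x i : U x -> smooth_fun_on U f -> smooth_fun_on U g ->
  partial p i (fun y => f y + g y) x = partial p i f x + partial p i g x.
Proof. by move=> Ux sf sg; rewrite partial.unlock (tderD Ux). Qed.

Lemma partialM p U f g x i : U x -> smooth_fun_on U f -> smooth_fun_on U g ->
  partial p i (fun y => f y * g y) x = f x * partial p i g x + g x * partial p i f x.
Proof. by move=> Ux sf sg; rewrite partial.unlock (tderM Ux). Qed.

Lemma partialZ p U f x i (a : R) : U x -> smooth_fun_on U f ->
  partial p i (fun y => a * f y) x = a * partial p i f x.
Proof.
move=> Ux sf; rewrite (partialM _ _ Ux (@smooth_fun_cst _ _ _ U a) sf).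
by rewrite partial_cst mulr0 addr0.
Qed.

Lemma partial_sum p U m (f : 'I_m -> M -> R) x i : U x ->
  (forall j, smooth_fun_on U (f j)) ->
  partial p i (fun y => \sum_j f j y) x = \sum_j partial p i (f j) x.
Proof. by move=> Ux sf; rewrite partial.unlock (tder_sum Ux). Qed.

Lemma partial_smooth p U f i : open U -> U `<=` chart_dom p ->
  smooth_fun_on U f -> smooth_fun_on U (partial p i f).
Proof.
by move=> oU Up sf; rewrite partial.unlock frame.unlock; exact: smooth_partial.
Qed.

End Frame.

Section Connection.
Context {R : realType} {n : nat} {M : smoothManifold R n}.
Implicit Types (p x : M) (U V : set M) (f : M -> R) (v w : 'rV[R]_n).
Implicit Types X Y Z : vfield M.
Variables (D : covder M) (conD : connection D).

Lemma covder_sumv x U m (a : 'I_m -> R) (v : 'I_m -> 'rV[R]_n) Y :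
  open U -> U x -> smooth_vfield_on U Y ->
  D x (\sum_i a i *: v i) Y = \sum_i a i *: D x (v i) Y.
Proof.
move=> oU Ux sY; elim: m a v => [|m IH] a v.
  rewrite !big_ord0; have := conn_linear conD 1 0 0 oU Ux sY.
  by rewrite scaler0 add0r scale1r => /eqP; rewrite -subr_eq subrr => /eqP <-.
by rewrite !big_ord_recl (conn_linear conD _ _ _ oU Ux sY) IH.
Qed.

Lemma covder0v x U Y : open U -> U x -> smooth_vfield_on U Y -> D x 0 Y = 0.
Proof.
move=> oU Ux sY; have := @covder_sumv x U 0 (fun=> 0) (fun=> 0) Y oU Ux sY.
by rewrite !big_ord0.
Qed.

(** A covariant derivative only depends on the germ of the field: the
    difference of two fields that agree on U is its own product with the
    indicator function of the complement of U, which vanishes near x. *)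
Lemma covder_local x U v Y Z : open U -> U x -> smooth_vfield_on U Y ->
  (forall y, U y -> Y y = Z y) -> D x v Y = D x v Z.
Proof.
move=> oU Ux sY YZ; pose W : vfield M := fun y => Y y - Z y.
have sZ : smooth_vfield_on U Z := smooth_vfield_eq YZ sY.
have W0 y : U y -> 0 = W y by move=> Uy; rewrite /W YZ// subrr.
have sW : smooth_vfield_on U W := smooth_vfield_eq W0 (@smooth_vfield0 _ _ _ U).
pose chi y : R := if `[< U y >] then 0 else 1.
have chi0 y : U y -> 0 = chi y by move=> Uy; rewrite /chi asboolT.
have schi : smooth_fun_on U chi.
  exact: smooth_fun_eq oU chi0 (@smooth_fun_cst _ _ _ U 0).
have DW : D x v W = 0.
  have -> : W = fun y => chi y *: W y.
    apply/funext => y; rewrite /chi; case: asboolP => Uy; last by rewrite scale1r.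
    by rewrite -W0// scaler0.
  rewrite (conn_leibniz conD v oU Ux schi sW) -W0// scaler0 add0r.
  by rewrite -chi0// scale0r.
have -> : Y = fun y => Z y + W y by apply/funext => y; rewrite /W addrC subrK.
by rewrite (conn_add conD v oU Ux sZ sW) DW addr0.
Qed.

Lemma covder_sum x U v m (f : 'I_m -> M -> R) (Y : 'I_m -> vfield M) :
  open U -> U x -> (forall i, smooth_fun_on U (f i)) ->
  (forall i, smooth_vfield_on U (Y i)) ->
  D x v (fun y => \sum_i f i y *: Y i y) =
  \sum_i (tder (f i) x v *: Y i x + f i x *: D x v (Y i)).
Proof.
move=> oU Ux; elim: m f Y => [|m IH] f Y sf sY.
  rewrite big_ord0; under eq_fun do rewrite big_ord0.
  have := conn_leibniz conD v oU Ux (@smooth_fun_cst _ _ _ U 0)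
    (@smooth_vfield0 _ _ _ U).
  by rewrite !scaler0 scale0r addr0.
under eq_fun do rewrite big_ord_recl.
rewrite (conn_add conD v oU Ux); last 2 first.
- exact: smooth_vfieldZ.
- by apply: smooth_vfield_sum => i; exact: smooth_vfieldZ.
by rewrite IH// big_ord_recl (conn_leibniz conD v oU Ux).
Qed.

(** The last index is the upper one. *)
Definition christoffel p i j k x : R := coframe p k x (D x (frame p i x) (frame p j)).

Lemma covder_frame p x i j : chart_dom p x ->
  D x (frame p i x) (frame p j) = \sum_k christoffel p i j k x *: frame p k x.
Proof. by move=> px; exact: frame_decomposition. Qed.

Lemma smooth_christoffel p i j k :
  smooth_fun_on (chart_dom p) (christoffel p i j k).
Proof.
apply: smooth_coframe; [exact: chart_dom_open|by []|].
by apply: (conn_smooth conD (@chart_dom_open _ _ _ p)); exact: smooth_frame.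
Qed.

Lemma coframe_covder p x U Y i k : open U -> U `<=` chart_dom p -> U x ->
  smooth_vfield_on U Y ->
  coframe p k x (D x (frame p i x) Y) =
  partial p i (fun y => coframe p k y (Y y)) x
  + \sum_j coframe p j x (Y x) * christoffel p i j k x.
Proof.
move=> oU Up Ux sY; have px := Up x Ux.
have sE j : smooth_vfield_on U (frame p j).
  exact: smooth_frame_sub.
have sy j : smooth_fun_on U (fun y => coframe p j y (Y y)).
  exact: smooth_coframe.
rewrite (@covder_local x U _ Y (fun y => \sum_j coframe p j y (Y y) *: frame p j y))//;
  last by move=> y Uy; exact: frame_decomposition (Up y Uy).
rewrite (covder_sum _ oU Ux sy sE) big_split /=.
rewrite -[X in X + _]scale1r coframeD// mul1r !coframe_sum//; congr (_ + _).
under eq_bigr do rewrite coframe_frame//.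
rewrite partial.unlock (bigD1 k)//= eqxx mulr1 big1 ?addr0// => j jk.
by rewrite [k == j]eq_sym (negPf jk) mulr0.
Qed.

Lemma curvature_christoffel p i j k l :
  curvature_at D p (delta_mx 0 i) (delta_mx 0 j) (delta_mx 0 k) 0 l =
  partial p i (christoffel p j k l) p - partial p j (christoffel p i k l) p
  + \sum_m (christoffel p j k m p * christoffel p i m l p
            - christoffel p i k m p * christoffel p j m l p).
Proof.
have pp := mem_chart_dom p; have op := @chart_dom_open _ _ _ p.
have sE i' : smooth_vfield_on (chart_dom p) (frame p i').
  exact: smooth_frame.
have H i' j' : (nabla D (frame p i') (nabla D (frame p j') (frame p k)) p) 0 l =
    partial p i' (christoffel p j' k l) p +
    \sum_m christoffel p j' k m p * christoffel p i' m l p.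
  rewrite -(coframe_center p).
  exact: (coframe_covder i' l op (@subset_refl _ _) pp
    (conn_smooth conD op (sE j') (sE k))).
have B0 : nabla D (bracket (frame p i) (frame p j)) (frame p k) p = 0.
  rewrite /nabla bracket_frame//; exact: covder0v op pp (sE k).
transitivity ((nabla D (frame p i) (nabla D (frame p j) (frame p k)) p
   - nabla D (frame p j) (nabla D (frame p i) (frame p k)) p
   - nabla D (bracket (frame p i) (frame p j)) (frame p k) p) 0 l).
  by rewrite /curvature_at /curvature frame.unlock.
have mxB (u v : 'rV[R]_n) : (u - v) 0 l = u 0 l - v 0 l by rewrite !mxE.
rewrite B0 subr0 mxB !H sumrB.
by rewrite opprD addrACA.
Qed.

Lemma ricci_christoffel p j k :
  ricci D p (delta_mx 0 j) (delta_mx 0 k) =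
  \sum_i (partial p i (christoffel p j k i) p
          - partial p j (christoffel p i k i) p
          + \sum_m (christoffel p j k m p * christoffel p i m i p
                    - christoffel p i k m p * christoffel p j m i p)).
Proof.
rewrite /ricci /mxtrace; apply: eq_bigr => i _.
by rewrite mxE curvature_christoffel.
Qed.

Lemma hessian_christoffel p U f i j : open U -> U p -> smooth_fun_on U f ->
  hessian D f p (delta_mx 0 i) (delta_mx 0 j) =
  partial p i (partial p j f) p - \sum_k christoffel p i j k p * partial p k f p.
Proof.
move=> oU Up sf; rewrite partial_center.
rewrite -(tder_partial _ _ Up)// -covder_frame; last exact: mem_chart_dom.
by rewrite frame_center partial.unlock frame.unlock.
Qed.

End Connection.

Section Metric.
Context {R : realType} {n : nat} {M : smoothManifold R n}.
Implicit Types (p x : M) (U V : set M) (v w : 'rV[R]_n).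
Variables (g : bilin_field M) (gR : riemannian_metric g).

Lemma metricDl x u v w : g x (u + v) w = g x u w + g x v w.
Proof. by rewrite -[u]scale1r (metric_linear gR) mul1r scale1r. Qed.

Lemma metric0l x w : g x 0 w = 0.
Proof.
by have /eqP := metricDl x 0 0 w; rewrite addr0 -subr_eq subrr => /eqP.
Qed.

Lemma metricZl x a u w : g x (a *: u) w = a * g x u w.
Proof. by rewrite -[a *: u]addr0 (metric_linear gR) metric0l addr0. Qed.

Lemma metricDr x u v w : g x w (u + v) = g x w u + g x w v.
Proof. by rewrite !(Defs.metric_sym gR x w) metricDl. Qed.

Lemma metricZr x a u w : g x w (a *: u) = a * g x w u.
Proof. by rewrite !(Defs.metric_sym gR x w) metricZl. Qed.

Lemma metric_suml x m (a : 'I_m -> R) (v : 'I_m -> 'rV[R]_n) w :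
  g x (\sum_i a i *: v i) w = \sum_i a i * g x (v i) w.
Proof.
elim: m a v => [|m IH] a v; first by rewrite !big_ord0 metric0l.
by rewrite !big_ord_recl metricDl IH metricZl.
Qed.

Lemma metric_sumr x m (a : 'I_m -> R) (v : 'I_m -> 'rV[R]_n) w :
  g x w (\sum_i a i *: v i) = \sum_i a i * g x w (v i).
Proof.
rewrite (Defs.metric_sym gR) metric_suml.
by apply: eq_bigr => i _; rewrite (Defs.metric_sym gR).
Qed.

Definition gcoef p i j x : R := g x (frame p i x) (frame p j x).

Lemma gcoef_sym p i j x : gcoef p i j x = gcoef p j i x.
Proof. exact: Defs.metric_sym. Qed.

Lemma gcoef_center p i j : gcoef p i j p = g p (delta_mx 0 i) (delta_mx 0 j).
Proof. by rewrite /gcoef !frame_center. Qed.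

Lemma smooth_gcoef p i j : smooth_fun_on (chart_dom p) (gcoef p i j).
Proof.
by apply: (metric_smooth gR); [exact: chart_dom_open|exact: smooth_frame..].
Qed.

(** The tangent vector with components a - b is orthogonal to the frame, hence
    to itself. *)
Lemma gcoef_nondegenerate p x (a b : 'I_n -> R) : chart_dom p x ->
  (forall k, \sum_l a l * gcoef p l k x = \sum_l b l * gcoef p l k x) -> a =1 b.
Proof.
move=> px E k; pose w := \sum_l (a l - b l) *: frame p l x.
have gw l : g x w (frame p l x) = 0.
  rewrite /w metric_suml; under eq_bigr do rewrite mulrBl.
  by rewrite sumrB; apply/eqP; rewrite subr_eq0; apply/eqP; exact: E.
have w0 : w = 0.
  apply: contrapT => /eqP /(Defs.metric_pos gR x); rewrite {2}/w metric_sumr.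
  by rewrite big1 ?ltxx// => l _; rewrite gw mulr0.
have : coframe p k x w = a k - b k.
  rewrite /w coframe_sum// (bigD1 k)//= big1 => [|l lk].
    by rewrite coframe_frame// eqxx mulr1 addr0.
  by rewrite coframe_frame// eq_sym (negPf lk) mulr0.
rewrite w0 coframe0 => /esym/eqP.
by rewrite subr_eq0 => /eqP.
Qed.

Lemma gramE x u v : g x u v = (u *m gram (g x) *m v^T) 0 0.
Proof.
rewrite {1}(row_sum_delta u) {1}(row_sum_delta v) metric_suml mxE.
under eq_bigr do rewrite metric_sumr mulr_sumr.
rewrite exchange_big; apply: eq_bigr => j _ /=; rewrite !mxE mulr_suml.
by apply: eq_bigr => i _; rewrite !mxE; ring.
Qed.

Lemma gram_unit x : gram (g x) \in unitmx.
Proof.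
rewrite -row_free_unit -kermx_eq0; apply/eqP/eqP/rowV0P => v /sub_kermxP vG.
apply: contrapT => /eqP /(Defs.metric_pos gR x).
by rewrite gramE vG mul0mx mxE ltxx.
Qed.

Lemma gram_sym x : (gram (g x))^T = gram (g x).
Proof. by apply/matrixP => i j; rewrite !mxE (Defs.metric_sym gR). Qed.

Section LeviCivita.
Variables (D : covder M) (lcD : levi_civita g D).
Let conD := lc_connection lcD.

Lemma christoffel_sym p i j k x : chart_dom p x ->
  christoffel D p i j k x = christoffel D p j i k x.
Proof.
move=> px; have sE i' := smooth_frame (p := p) i'.
have := lc_torsion_free lcD (@chart_dom_open _ _ _ p) px (sE i) (sE j).
rewrite (bracket_frame i j px) => /subr0_eq E.
rewrite /christoffel; congr (coframe p k x _); exact: E.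
Qed.

Lemma gcoef_compatible p i j k x : chart_dom p x ->
  partial p i (gcoef p j k) x =
  \sum_l christoffel D p i j l x * gcoef p l k x
  + \sum_l christoffel D p i k l x * gcoef p j l x.
Proof.
move=> px; have sE i' := smooth_frame (p := p) i'.
have := lc_metric lcD (@chart_dom_open _ _ _ p) px (sE i) (sE j) (sE k).
rewrite partial.unlock /gcoef => ->; rewrite /nabla !(covder_frame D _ _ px).
by rewrite metric_suml metric_sumr.
Qed.

Lemma koszul p i j k x : chart_dom p x ->
  2 * (\sum_l christoffel D p i j l x * gcoef p l k x) =
  partial p i (gcoef p j k) x + partial p j (gcoef p i k) x
  - partial p k (gcoef p i j) x.
Proof.
move=> px; rewrite (gcoef_compatible i j k px) (gcoef_compatible j i k px).
rewrite (gcoef_compatible k i j px).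
apply: (koszul_sum (c := fun i j l => christoffel D p i j l x)
  (g := fun i j => gcoef p i j x)) => *.
  exact: christoffel_sym.
exact: gcoef_sym.
Qed.

End LeviCivita.
End Metric.

(** * Semi-symmetric metric connections *)

Section SemiSymmetricAlgebra.
Context {R : realType} {n : nat}.
Implicit Types (c : 'I_n -> 'I_n -> 'I_n -> R) (g : 'I_n -> 'I_n -> R).

(** The Ricci tensor in coordinates, when c are the Christoffel symbols and
    dc m i j k the derivative of c i j k in the direction m. *)
Definition ricci_coord c (dc : 'I_n -> 'I_n -> 'I_n -> 'I_n -> R) j k : R :=
  \sum_i (dc i j k i - dc j i k i + \sum_m (c j k m * c i m i - c i k m * c j m i)).

Lemma sum_delta m (a : 'I_m -> R) k : \sum_i a i * (i == k)%:R = a k.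
Proof.
rewrite (bigD1 k)//= eqxx mulr1 big1 ?addr0// => i /negPf ->.
by rewrite mulr0.
Qed.

Lemma sum_deltaC m (a : 'I_m -> R) k : \sum_i a i * (k == i)%:R = a k.
Proof. by under eq_bigr do rewrite eq_sym; exact: sum_delta. Qed.

Lemma sum_eqxx m : \sum_(i < m) (i == i)%:R = m%:R :> R.
Proof. by under eq_bigr do rewrite eqxx; rewrite sumr_const card_ord. Qed.

(** The products of a Christoffel symbol, g and P cancel against the derivative
    of g, except for those that enter the divergence of P; what remains besides
    the Ricci tensor of c is tensorial. *)
Lemma ricci_coord_semi_symmetric c dc g dg (P : 'I_n -> R) dP pi dpi
    (c' := fun i j k => c i j k + pi j * (i == k)%:R - g i j * P k)
    (dc' := fun m i j k => dc m i j k + dpi m j * (i == k)%:R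
                           - (dg m i j * P k + g i j * dP m k)) j k :
  (forall i j k, c i j k = c j i k) -> (forall i j, g i j = g j i) ->
  (forall i j k, dg i j k =
     \sum_l c i j l * g l k + \sum_l c i k l * g j l) ->
  (forall i, pi i = \sum_m P m * g i m) ->
  (forall i j, dpi i j = \sum_m (P m * dg i j m + dP i m * g j m)) ->
  ricci_coord c' dc' j k = ricci_coord c dc j k
  - (n%:R - 2) * (dpi j k - \sum_m c j k m * pi m - pi j * pi k)
  - (\sum_i (dP i i + \sum_m c i m i * P m) + (n%:R - 2) * \sum_m pi m * P m)
    * g j k.
Proof.
move=> cC gC dgE piE dpiE.
pose gam m := \sum_i c i m i.
have dgC i a b : dg i a b = dg i b a.
  by rewrite !dgE addrC; congr (_ + _); apply: eq_bigr => m _; rewrite gC.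
have dpiE' i l : \sum_m (dg i m l * P m + g m l * dP i m) = dpi i l.
  rewrite dpiE; apply: eq_bigr => m _; rewrite (gC m l) (dgC i m l) mulrC.
  by rewrite [dP _ _ * _]mulrC.
(* E1 to E5 expand the sums that make up the Ricci tensor of c'; compatibility
   with the metric enters through E6. *)
have E1 : \sum_i dc' i j k i = \sum_i dc i j k i + dpi j k
    - \sum_i P i * dg i j k - g j k * \sum_i dP i i.
  rewrite /dc' !big_split /= sumrN (sum_deltaC (fun i => dpi i k)) big_split /=.
  rewrite -mulr_sumr opprD addrA; congr (_ - _ - _).
  by apply: eq_bigr => i _; rewrite mulrC.
have E2 : \sum_i dc' j i k i = \sum_i dc j i k i + (n%:R - 1) * dpi j k.
  rewrite /dc' !big_split /= sumrN dpiE' -mulr_sumr.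
  by rewrite sum_eqxx; ring.
have E3 m : \sum_i c' i m i = gam m + (n%:R - 1) * pi m.
  rewrite /c' !big_split /= sumrN -mulr_sumr sum_eqxx.
  have -> : \sum_i g i m * P i = pi m.
    by rewrite piE; apply: eq_bigr => i _; rewrite mulrC gC.
  by rewrite /gam; ring.
pose p2 := \sum_m pi m * P m.
have p2k l : \sum_m g l m * P m = pi l.
  by rewrite piE; apply: eq_bigr => i _; rewrite mulrC.
have E4 : \sum_m c' j k m * (gam m + (n%:R - 1) * pi m) =
   \sum_m c j k m * gam m + (n%:R - 1) * \sum_m c j k m * pi m
   + pi k * (gam j + (n%:R - 1) * pi j) - g j k * \sum_m P m * gam m
   - (n%:R - 1) * g j k * p2.
  transitivity (\sum_m (c j k m * gam m + (n%:R - 1) * (c j k m * pi m)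
     + pi k * (gam m + (n%:R - 1) * pi m) * (j == m)%:R
     - g j k * (P m * gam m) - (n%:R - 1) * g j k * (pi m * P m))).
    by apply: eq_bigr => m _; rewrite /c'; ring.
  rewrite !big_split /= !sumrN -!mulr_sumr.
  by rewrite (sum_deltaC (fun m => pi k * (gam m + (n%:R - 1) * pi m))).
have cP i l m : c i l m = c l i m by [].
have E5 : \sum_i \sum_m c' i k m * c' j m i =
   \sum_i \sum_m c i k m * c j m i
   + \sum_m c j k m * pi m - \sum_i P i * \sum_m c i k m * g j m
   + pi k * gam j + pi k * pi j - pi k * pi j
   - \sum_i P i * \sum_m c j i m * g k m - g j k * p2 + pi j * pi k.
  transitivity (\sum_i (\sum_m c i k m * c j m i
     + (\sum_m c i k m * pi m) * (j == i)%:R - P i * \sum_m c i k m * g j m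
     + pi k * c j i i + pi k * pi i * (j == i)%:R - pi k * (g j i * P i)
     - g i k * \sum_m P m * c j m i - g i k * p2 * (j == i)%:R
     + g k i * P i * pi j)).
    apply: eq_bigr => i _.
    transitivity (\sum_m (c i k m * c j m i + c i k m * pi m * (j == i)%:R
      - P i * (c i k m * g j m)
      + pi k * c j m i * (i == m)%:R + pi k * pi m * (j == i)%:R * (i == m)%:R
      - pi k * g j m * P i * (i == m)%:R
      - g i k * (P m * c j m i) - g i k * (pi m * P m) * (j == i)%:R
      + g i k * (g j m * P m) * P i)).
      by apply: eq_bigr => m _; rewrite /c'; ring.
    rewrite !big_split /= !sumrN.
    rewrite (sum_deltaC (fun m => pi k * c j m i)).
    rewrite (sum_deltaC (fun m => pi k * pi m * (j == i)%:R)).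
    rewrite (sum_deltaC (fun m => pi k * g j m * P i)).
    rewrite -!mulr_suml -!mulr_sumr p2k (gC k i) /p2.
    by ring.
  rewrite !big_split /= !sumrN -!mulr_sumr -!mulr_suml p2k.
  rewrite (sum_deltaC (fun i => \sum_m c i k m * pi m)).
  rewrite (sum_deltaC (fun i => pi k * pi i)).
  rewrite (sum_deltaC (fun i => g i k * p2)) p2k.
  have -> : \sum_i c j i i = gam j by apply: eq_bigr => i _; rewrite cC.
  have -> : \sum_i g i k * (\sum_m P m * c j m i) =
      \sum_i P i * \sum_m c j i m * g k m.
    under eq_bigr do rewrite mulr_sumr; rewrite exchange_big /=.
    apply: eq_bigr => m _; rewrite mulr_sumr; apply: eq_bigr => i _.
    by rewrite (gC k i); ring.
  by ring.
have E6 : \sum_i P i * dg i j k = \sum_i P i * (\sum_m c j i m * g k m)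
    + \sum_i P i * \sum_m c i k m * g j m.
  rewrite -big_split /=; apply: eq_bigr => i _; rewrite dgE mulrDr.
  by congr (_ * _ + _); apply: eq_bigr => m _; rewrite cC gC.
have E7 : \sum_i \sum_m c i m i * P m = \sum_m P m * gam m.
  rewrite exchange_big; apply: eq_bigr => m _ /=; rewrite /gam mulr_sumr.
  by apply: eq_bigr => i _; rewrite mulrC.
have ricE d d' : ricci_coord d d' j k = \sum_i d' i j k i - \sum_i d' j i k i
   + (\sum_m d j k m * \sum_i d i m i) - \sum_i \sum_m d i k m * d j m i.
  rewrite /ricci_coord !big_split /= !sumrN.
  under [X in _ + X]eq_bigr do rewrite sumrB.
  rewrite sumrB addrA; congr (_ + _ - _); rewrite exchange_big /=.
  by apply: eq_bigr => m _; rewrite mulr_sumr.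
rewrite !ricE; under [X in _ + X - _]eq_bigr do rewrite E3.
rewrite E1 E2 E4 E5 big_split /= E7 E6 -/p2.
rewrite -[\sum_m c j k m * \sum_i c i m i]/(\sum_m c j k m * gam m).
by ring.
Qed.

End SemiSymmetricAlgebra.

Section MetricTrace.
Context {R : realType} {n : nat} {M : smoothManifold R n}.
Variables (g : bilin_field M) (gR : riemannian_metric g) (p : M).
Implicit Types T : 'rV[R]_n -> 'rV[R]_n -> R.

Lemma metric_trace_sum T :
  metric_trace (g p) T = \sum_j \sum_k
    invmx (gram (g p)) j k * T (delta_mx 0 k) (delta_mx 0 j).
Proof.
rewrite /metric_trace /mxtrace; apply: eq_bigr => j _; rewrite mxE.
by apply: eq_bigr => k _; rewrite mxE.
Qed.

Lemma metric_traceM (A : 'M[R]_n) : \tr (invmx (gram (g p)) *m (A *m gram (g p))) = \tr A.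
Proof. by rewrite mulmxA mxtrace_mulC mulmxA mulmxV ?mul1mx//; exact: gram_unit gR p. Qed.

Lemma metric_trace_endo (L : 'rV[R]_n -> 'rV[R]_n) :
  metric_trace (g p) (fun u v => g p (L u) v) = \tr (lin1_mx L).
Proof.
rewrite -(metric_traceM (lin1_mx L)) /metric_trace; congr (\tr (_ *m _)).
apply/matrixP => i j; rewrite !mxE {1}(row_sum_delta (L _)) (metric_suml gR).
by apply: eq_bigr => k _; rewrite !mxE.
Qed.

Lemma metric_trace_metric : metric_trace (g p) (g p) = n%:R.
Proof. by rewrite -(mxtrace1 R n) -(metric_traceM 1%:M) mul1mx. Qed.

Lemma metric_trace_square (w : 'rV[R]_n) :
  metric_trace (g p) (fun u v => g p u w * g p v w) = g p w w.
Proof.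
rewrite (gramE gR p w w) /metric_trace.
have -> : gram (fun u v => g p u w * g p v w) =
    (gram (g p) *m w^T) *m (w *m gram (g p)).
  have gw i : g p (delta_mx 0 i) w = (gram (g p) *m w^T) i 0.
    rewrite {1}(row_sum_delta w) (metric_sumr gR) mxE.
    by apply: eq_bigr => k _; rewrite !mxE mulrC.
  apply/matrixP => i j; rewrite [LHS]mxE [RHS]mxE big_ord1 !gw; congr (_ * _).
  by rewrite -[w *m _]trmxK trmx_mul (gram_sym gR) [RHS]mxE.
rewrite !mulmxA mulVmx ?mul1mx; last exact: gram_unit gR p.
by rewrite -mulmxA mxtrace_mulC /mxtrace big_ord1.
Qed.

Lemma metric_trace_eq T T' :
  (forall j k, T (delta_mx 0 j) (delta_mx 0 k) = T' (delta_mx 0 j) (delta_mx 0 k)) ->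
  metric_trace (g p) T = metric_trace (g p) T'.
Proof.
move=> TT'; rewrite /metric_trace; congr (\tr (_ *m _)).
by apply/matrixP => i j; rewrite !mxE.
Qed.

Lemma metric_trace_lin T T' a :
  metric_trace (g p) (fun u v => T u v - a * T' u v) =
  metric_trace (g p) T - a * metric_trace (g p) T'.
Proof.
rewrite /metric_trace -mxtraceZ -raddfB; congr (\tr _).
rewrite scalemxAr -mulmxBr; congr (_ *m _).
by apply/matrixP => i j; rewrite !mxE.
Qed.

End MetricTrace.

Section SemiSymmetric.
Context {R : realType} {n : nat} {M : smoothManifold R n}.
Variables (g : bilin_field M) (gR : riemannian_metric g).
Variables (D : covder M) (P : vfield M) (sP : smooth_vfield_on setT P).
Implicit Types p x : M.

Let sPU U : smooth_vfield_on U P.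
Proof. exact: smooth_vfield_sub sP. Qed.

Lemma semi_symmetric_connection :
  connection D -> connection (semi_symmetric g D P).
Proof.
move=> conD; split.
- move=> U p a u v Y oU Up sY; rewrite /semi_symmetric.
  rewrite (conn_linear conD _ _ _ oU Up sY) (metric_linear gR).
  by apply/rowP => i; rewrite !mxE; ring.
- move=> U p v Y Z oU Up sY sZ; rewrite /semi_symmetric.
  rewrite (conn_add conD _ oU Up sY sZ) (metricDl gR) (metricDr gR).
  by apply/rowP => i; rewrite !mxE; ring.
- move=> U p v f Y oU Up sf sY; rewrite /semi_symmetric.
  rewrite (conn_leibniz conD _ oU Up sf sY) (metricZl gR) (metricZr gR).
  by apply/rowP => i; rewrite !mxE; ring.
- move=> U X Y oU sX sY.
  pose A x := nabla D X Y x + g x (Y x) (P x) *: X x.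
  pose B x := (-1 * g x (X x) (Y x)) *: P x.
  have sA : smooth_vfield_on U A.
    apply: (smooth_vfieldD (conn_smooth conD oU sX sY)).
    apply: (smooth_vfieldZ _ sX).
    exact: (metric_smooth gR oU sY (sPU (U := U))).
  have sB : smooth_vfield_on U B.
    apply: (smooth_vfieldZ _ (sPU (U := U))).
    apply: (smooth_funM oU (@smooth_fun_cst _ _ _ U (-1))).
    exact: (metric_smooth gR oU sX sY).
  apply: smooth_vfield_eq (smooth_vfieldD sA sB) => x _.
  by rewrite /A /B mulN1r scaleNr.
Qed.

Variable (lcD : levi_civita g D).
Let conD := lc_connection lcD.

(** Components, in the chart at p, of P and of the 1-form pi dual to it. *)
Let Pc p k x := coframe p k x (P x).
Let pic p j x := g x (frame p j x) (P x).

Let smooth_Pc p k : smooth_fun_on (chart_dom p) (Pc p k).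
Proof. exact: smooth_coframe (@chart_dom_open _ _ _ p) _ _. Qed.

Let smooth_pic p k : smooth_fun_on (chart_dom p) (pic p k).
Proof.
exact: (metric_smooth gR (@chart_dom_open _ _ _ p) (smooth_frame (p := p) k) (sPU (U := _))).
Qed.

Let picE p j x : chart_dom p x -> pic p j x = \sum_m Pc p m x * gcoef g p j m x.
Proof.
move=> px; rewrite /pic {1}(frame_decomposition (P x) px).
by rewrite (metric_sumr gR).
Qed.

Lemma christoffel_semi_symmetric p i j k x : chart_dom p x ->
  christoffel (semi_symmetric g D P) p i j k x =
  christoffel D p i j k x + pic p j x * (i == k)%:R
  + -1 * (gcoef g p i j x * Pc p k x).
Proof.
move=> px; rewrite /christoffel /semi_symmetric -/(gcoef g p i j x).
rewrite -scaleNr addrC coframeD// addrC [D _ _ _ + _]addrC coframeD//.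
by rewrite coframe_frame// eq_sym -/(pic p j x) /Pc; ring.
Qed.

(** At the centre of the chart the sums left by [ricci_coord_semi_symmetric] are
    the covariant derivative of pi, which is dual to that of P as the
    connection is metric, and the trace of the covariant derivative of P. *)
Lemma ricci_semi_symmetric p j k :
  ricci (semi_symmetric g D P) p (delta_mx 0 j) (delta_mx 0 k) =
  ricci D p (delta_mx 0 j) (delta_mx 0 k)
  - (n%:R - 2) * (g p (D p (delta_mx 0 j) P) (delta_mx 0 k)
       - g p (delta_mx 0 j) (P p) * g p (delta_mx 0 k) (P p))
  - (\tr (lin1_mx (fun u => D p u P)) + (n%:R - 2) * g p (P p) (P p))
    * g p (delta_mx 0 j) (delta_mx 0 k).
Proof.
have pp := mem_chart_dom p; have op := @chart_dom_open _ _ _ p.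
have sc a b c : smooth_fun_on (chart_dom p) (christoffel D p a b c).
  exact: smooth_christoffel.
have sg a b : smooth_fun_on (chart_dom p) (gcoef g p a b) by exact: smooth_gcoef.
have sPc := @smooth_Pc p; have spic := @smooth_pic p.
have dct m a b c : partial p m (christoffel (semi_symmetric g D P) p a b c) p =
    partial p m (christoffel D p a b c) p
    + partial p m (pic p b) p * (a == c)%:R
    - (partial p m (gcoef g p a b) p * Pc p c p
       + gcoef g p a b p * partial p m (Pc p c) p).
  rewrite (partial_near (g := fun x => christoffel D p a b c x
    + pic p b x * (a == c)%:R + -1 * (gcoef g p a b x * Pc p c x)) p m op pp);
    last by move=> y py; exact: christoffel_semi_symmetric.
  have s1 := smooth_funM op (spic b) (@smooth_fun_cst _ _ M (chart_dom p) (a == c)%:R).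
  have s2 := smooth_funM op (sg a b) (sPc c).
  have s3 := smooth_funM op (@smooth_fun_cst _ _ M (chart_dom p) (-1)) s2.
  rewrite (partialD _ _ pp (smooth_funD op (sc a b c) s1) s3).
  rewrite (partialD _ _ pp (sc a b c) s1) (partialZ _ _ _ pp s2).
  rewrite (partialM _ _ pp (sg a b) (sPc c)).
  rewrite (partialM _ _ pp (spic b) (@smooth_fun_cst _ _ M _ _)) partial_cst.
  by ring.
have E := @ricci_coord_semi_symmetric R n (fun a b c => christoffel D p a b c p)
  (fun m a b c => partial p m (christoffel D p a b c) p)
  (fun a b => gcoef g p a b p) (fun m a b => partial p m (gcoef g p a b) p)
  (fun m => Pc p m p) (fun m a => partial p m (Pc p a) p)
  (fun a => pic p a p) (fun m a => partial p m (pic p a) p) j k.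
have ricE D' : connection D' -> ricci D' p (delta_mx 0 j) (delta_mx 0 k) =
    ricci_coord (fun a b c => christoffel D' p a b c p)
      (fun m a b c => partial p m (christoffel D' p a b c) p) j k.
  by move=> conD'; exact: ricci_christoffel.
rewrite (ricE _ (semi_symmetric_connection conD)) (ricE _ conD).
have -> : (fun a b c => christoffel (semi_symmetric g D P) p a b c p) =
    (fun a b c => christoffel D p a b c p + pic p b p * (a == c)%:R
                  - gcoef g p a b p * Pc p c p).
  by do 3![apply/funext => ?]; rewrite christoffel_semi_symmetric// mulN1r.
have -> : (fun m a b c => partial p m (christoffel (semi_symmetric g D P) p a b c) p) =
    (fun m a b c => partial p m (christoffel D p a b c) p
      + partial p m (pic p b) p * (a == c)%:R
      - (partial p m (gcoef g p a b) p * Pc p c p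
         + gcoef g p a b p * partial p m (Pc p c) p)).
  by do 4![apply/funext => ?]; exact: dct.
rewrite {}E; last 5 first.
- by move=> a b c; exact: (christoffel_sym lcD).
- by move=> a b; exact: (gcoef_sym gR).
- by move=> a b c; exact: (gcoef_compatible gR lcD).
- by move=> a; rewrite picE.
- move=> m a; rewrite (partial_near (g := fun x =>
    \sum_l Pc p l x * gcoef g p a l x) p m op pp); last by move=> *; exact: picE.
  rewrite (partial_sum _ _ pp); last by move=> l; exact: smooth_funM.
  by apply: eq_bigr => l _; rewrite (partialM _ _ pp)//; ring.
have Pp : P p = \sum_m Pc p m p *: frame p m p by exact: frame_decomposition.
have -> : \sum_m pic p m p * Pc p m p = g p (P p) (P p).
  rewrite {1}Pp (metric_suml gR).
  by apply: eq_bigr => m _; rewrite mulrC.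
have -> : \sum_i (partial p i (Pc p i) p
      + \sum_m christoffel D p i m i p * Pc p m p) =
    \tr (lin1_mx (fun u => D p u P)).
  apply: eq_bigr => i _; rewrite mxE -(coframe_center p) -(frame_center p i).
  rewrite (coframe_covder conD _ _ op (@subset_refl _ _) pp (sPU (U := _))).
  by congr (_ + _); apply: eq_bigr => m _; rewrite mulrC.
have -> : partial p j (pic p k) p - \sum_m christoffel D p j k m p * pic p m p =
    g p (D p (delta_mx 0 j) P) (delta_mx 0 k).
  have := lc_metric lcD op pp (smooth_frame (p := p) j) (smooth_frame (p := p) k)
    (sPU (U := chart_dom p)).
  rewrite /nabla (covder_frame D j k pp) (metric_suml gR) !frame_center.
  rewrite -partial_center -/(pic p k) => ->.
  by rewrite addrC addKr (Defs.metric_sym gR).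
by rewrite gcoef_center /pic !frame_center.
Qed.

(** The traces of nabla P, of the square of pi and of g are div P, |P|^2
    and n. *)
Lemma scalar_curvature_semi_symmetric p :
  scalar_curvature g (semi_symmetric g D P) p = scalar_curvature g D p
  - 2 * (n%:R - 1) * \tr (lin1_mx (fun u => D p u P))
  - (n%:R - 1) * (n%:R - 2) * g p (P p) (P p).
Proof.
pose N u v := g p (D p u P) v - 1 * (g p u (P p) * g p v (P p)).
pose s := \tr (lin1_mx (fun u => D p u P)) + (n%:R - 2) * g p (P p) (P p).
pose T u v := ricci D p u v - (n%:R - 2) * N u v.
rewrite /scalar_curvature.
rewrite (metric_trace_eq g p (T' := fun u v => T u v - s * g p u v)); last first.
  by move=> j k; rewrite ricci_semi_symmetric /T /N mul1r.
rewrite metric_trace_lin metric_trace_lin metric_trace_lin.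
rewrite (metric_trace_endo gR) (metric_trace_square gR) (metric_trace_metric gR).
by rewrite /s; ring.
Qed.

End SemiSymmetric.

(** * Coordinates adapted to a doubly warped metric *)

Section WarpedChart.
Context {R : realType} {n : nat} {M : smoothManifold R n}.
Implicit Types (p x : M) (D : covder M) (g : bilin_field M).

(** Functions G and c on the chart domain at p that are related, along the
    coordinate directions in the image of a block of indices, like the
    coefficients of a metric to the Christoffel symbols of its Levi-Civita
    connection. *)
Record metric_block p m (s : 'I_m -> 'I_n) (G : 'I_m -> 'I_m -> M -> R)
    (c : 'I_m -> 'I_m -> 'I_m -> M -> R) : Prop := MetricBlock {
  block_smooth : forall i j, smooth_fun_on (chart_dom p) (G i j);
  block_sym : forall i j x, G i j x = G j i x;
  block_torsion_free : forall i j k x, chart_dom p x -> c i j k x = c j i k x;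
  block_nondegenerate : forall (a b : 'I_m -> R) x, chart_dom p x ->
    (forall k, \sum_l a l * G l k x = \sum_l b l * G l k x) -> a =1 b;
  block_compatible : forall i j k x, chart_dom p x ->
    partial p (s i) (G j k) x =
    \sum_l c i j l x * G l k x + \sum_l c i k l x * G j l x
}.

Lemma block_koszul p m (s : 'I_m -> 'I_n) G c x i j k :
  metric_block p s G c -> chart_dom p x ->
  2 * (\sum_l c i j l x * G l k x) =
  partial p (s i) (G j k) x + partial p (s j) (G i k) x - partial p (s k) (G i j) x.
Proof.
move=> b px; rewrite !(block_compatible b)//.
apply: (koszul_sum (c := fun i j l => c i j l x) (g := fun i j => G i j x)) => *.
  exact: block_torsion_free b _ _ _ _ px.
exact: block_sym b _ _ _.
Qed.

(** The coordinate form of the doubly warped metric u1^2 G1 + u2^2 G2. It is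
    symmetric in the two blocks, so that the Ricci tensor needs to be computed
    on the first one only. *)
Record warped_chart p g n1 n2 (s1 : 'I_n1 -> 'I_n) (s2 : 'I_n2 -> 'I_n)
    (u1 u2 : M -> R) G1 G2 c1 c2 : Prop := WarpedChart {
  warped_sum : forall E : 'I_n -> R,
    \sum_i E i = \sum_i E (s1 i) + \sum_a E (s2 a);
  warped_block1 : metric_block p s1 G1 c1;
  warped_block2 : metric_block p s2 G2 c2;
  warped_pos1 : forall x, 0 < u1 x;
  warped_pos2 : forall x, 0 < u2 x;
  warped_smooth1 : smooth_fun_on (chart_dom p) u1;
  warped_smooth2 : smooth_fun_on (chart_dom p) u2;
  warped_metric11 : forall i j x, chart_dom p x ->
    gcoef g p (s1 i) (s1 j) x = u1 x ^+ 2 * G1 i j x;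
  warped_metric22 : forall a b x, chart_dom p x ->
    gcoef g p (s2 a) (s2 b) x = u2 x ^+ 2 * G2 a b x;
  warped_metric12 : forall i a x, chart_dom p x ->
    gcoef g p (s1 i) (s2 a) x = 0;
  warped_metric21 : forall i a x, chart_dom p x ->
    gcoef g p (s2 a) (s1 i) x = 0;
  warped_partial_u1 : forall i x, chart_dom p x -> partial p (s1 i) u1 x = 0;
  warped_partial_u2 : forall a x, chart_dom p x -> partial p (s2 a) u2 x = 0;
  warped_partial_G1 : forall a i j x, chart_dom p x ->
    partial p (s2 a) (G1 i j) x = 0;
  warped_partial_G2 : forall i a b x, chart_dom p x ->
    partial p (s1 i) (G2 a b) x = 0
}.

Lemma warped_chartC p g n1 n2 (s1 : 'I_n1 -> 'I_n) (s2 : 'I_n2 -> 'I_n)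
    u1 u2 G1 G2 c1 c2 :
  warped_chart p g s1 s2 u1 u2 G1 G2 c1 c2 ->
  warped_chart p g s2 s1 u2 u1 G2 G1 c2 c1.
Proof.
case=> sE ? ? ? ? ? ? ? ? m12 m21 *; split=> //.
- by move=> E; rewrite sE addrC.
- by move=> a i; exact: m21.
- by move=> a i; exact: m12.
Qed.

Section Christoffel.
Variables (g : bilin_field M) (gR : riemannian_metric g).
Variables (D : covder M) (lcD : levi_civita g D) (p : M).
Let op := @chart_dom_open _ _ _ p.

Lemma warped_partial_metric11 n1 n2 (s1 : 'I_n1 -> 'I_n) (s2 : 'I_n2 -> 'I_n)
    u1 u2 G1 G2 c1 c2 (W : warped_chart p g s1 s2 u1 u2 G1 G2 c1 c2) I i j x :
  chart_dom p x -> partial p I (gcoef g p (s1 i) (s1 j)) x =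
    u1 x ^+ 2 * partial p I (G1 i j) x + 2 * u1 x * partial p I u1 x * G1 i j x.
Proof.
move=> px; have su := warped_smooth1 W.
have sG := block_smooth (warped_block1 W) i j.
rewrite (partial_near (g := fun y => (u1 y * u1 y) * G1 i j y) p I op px); last first.
  by move=> y py; rewrite (warped_metric11 W).
rewrite (partialM _ _ px (smooth_funM op su su) sG) (partialM _ _ px su su).
by ring.
Qed.

Section Block.
Variables (n1 n2 : nat) (s1 : 'I_n1 -> 'I_n) (s2 : 'I_n2 -> 'I_n).
Variables (u1 u2 : M -> R) (G1 : 'I_n1 -> 'I_n1 -> M -> R).
Variables (G2 : 'I_n2 -> 'I_n2 -> M -> R).
Variables (c1 : 'I_n1 -> 'I_n1 -> 'I_n1 -> M -> R).
Variables (c2 : 'I_n2 -> 'I_n2 -> 'I_n2 -> M -> R).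
Hypothesis W : warped_chart p g s1 s2 u1 u2 G1 G2 c1 c2.
Local Notation Gam := (christoffel D p).

Let partial12 I i a x : chart_dom p x ->
  partial p I (gcoef g p (s1 i) (s2 a)) x = 0.
Proof.
move=> px; rewrite (partial_near (g := fun=> 0) p I op px) ?partial_cst//.
by move=> y py; exact: warped_metric12 W _ _ _ py.
Qed.

Let u1n x : u1 x != 0. Proof. by rewrite gt_eqF// (warped_pos1 W). Qed.
Let u2n x : u2 x != 0. Proof. by rewrite gt_eqF// (warped_pos2 W). Qed.

Let koszul1 I J k x : chart_dom p x ->
  2 * (u1 x ^+ 2 * \sum_l Gam I J (s1 l) x * G1 l k x) =
  partial p I (gcoef g p J (s1 k)) x + partial p J (gcoef g p I (s1 k)) x
  - partial p (s1 k) (gcoef g p I J) x.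
Proof.
move=> px; rewrite -(koszul gR lcD I J (s1 k) px) (warped_sum W).
rewrite [X in _ = _ * (_ + X)]big1 => [|a _]; last first.
  by rewrite (warped_metric21 W)// mulr0.
rewrite addr0 mulr_sumr; congr (_ * _); apply: eq_bigr => l _.
by rewrite (warped_metric11 W)//; ring.
Qed.

Let cancel1 (B : 'I_n1 -> R) I J x : chart_dom p x ->
  (forall k, 2 * (u1 x ^+ 2 * \sum_l Gam I J (s1 l) x * G1 l k x) =
     2 * (u1 x ^+ 2 * \sum_l B l * G1 l k x)) ->
  forall l, Gam I J (s1 l) x = B l.
Proof.
move=> px E; apply: (block_nondegenerate (warped_block1 W) px) => k.
have := E k; have n2' : (2 : R) != 0 by rewrite pnatr_eq0.
move=> /(mulfI n2') /mulfI; apply.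
by rewrite expf_neq0.
Qed.

(** Along the first block the metric is u1^2 G1 with u1 constant, so that the
    factor u1^2 cancels from the Koszul formula. *)
Lemma warped_christoffel111 i j k x : chart_dom p x ->
  Gam (s1 i) (s1 j) (s1 k) x = c1 i j k x.
Proof.
move=> px; move: k; apply: (cancel1 px) => k; rewrite koszul1//.
rewrite !(warped_partial_metric11 W)// !(warped_partial_u1 W)//.
have := block_koszul i j k (warped_block1 W) px => /(congr1 (fun t => u1 x ^+ 2 * t)) E.
by rewrite [RHS]mulrCA E; ring.
Qed.

(** In the Koszul formula only the derivative of u1^2 along the second block
    survives, and it is half the logarithmic derivative of u1^2 that remains. *)
Lemma warped_christoffel121 i a k x : chart_dom p x ->
  Gam (s1 i) (s2 a) (s1 k) x = partial p (s2 a) u1 x / u1 x * (i == k)%:R.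
Proof.
move=> px; move: k; apply: (cancel1 px) => k; rewrite koszul1//.
rewrite !partial12// (warped_partial_metric11 W)// (warped_partial_G1 W)//.
rewrite (partial_near (g := fun=> 0) p (s1 i) op px); last first.
  by move=> y py; rewrite (warped_metric21 W).
rewrite partial_cst.
transitivity (2 * (u1 x ^+ 2 * (partial p (s2 a) u1 x / u1 x * G1 i k x))).
  by field; exact: u1n.
congr (_ * (_ * _)).
under eq_bigr do rewrite mulrAC; rewrite (sum_deltaC (fun l => _ * G1 l k x)).
by [].
Qed.

(** This component is proportional to the gradient of u1. It is left with a
    lowered index, to be differentiated without involving an inverse matrix. *)
Lemma warped_christoffel112 j k c x : chart_dom p x ->
  u2 x ^+ 2 * \sum_b G2 b c x * Gam (s1 j) (s1 k) (s2 b) x =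
  - (u1 x * partial p (s2 c) u1 x * G1 j k x).
Proof.
move=> px; have := koszul gR lcD (s1 j) (s1 k) (s2 c) px.
rewrite !partial12// (warped_partial_metric11 W)// (warped_partial_G1 W)//.
rewrite (warped_sum W) [X in _ * (X + _)]big1 => [|i _]; last first.
  by rewrite (warped_metric12 W)// mulr0.
rewrite add0r mulr0 !add0r => E; apply: (mulfI (_ : (2 : R) != 0)).
  by rewrite pnatr_eq0.
transitivity (- (2 * u1 x * partial p (s2 c) u1 x * G1 j k x)); last by ring.
rewrite -E; congr (_ * _); rewrite mulr_sumr; apply: eq_bigr => b _.
by rewrite (warped_metric22 W)//; ring.
Qed.

End Block.

Section RicciBlock.
Variables (n1 n2 : nat) (s1 : 'I_n1 -> 'I_n) (s2 : 'I_n2 -> 'I_n).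
Variables (u1 u2 : M -> R) (G1 : 'I_n1 -> 'I_n1 -> M -> R).
Variables (G2 : 'I_n2 -> 'I_n2 -> M -> R).
Variables (c1 : 'I_n1 -> 'I_n1 -> 'I_n1 -> M -> R).
Variables (c2 : 'I_n2 -> 'I_n2 -> 'I_n2 -> M -> R).
Hypothesis W : warped_chart p g s1 s2 u1 u2 G1 G2 c1 c2.
Local Notation Gam := (christoffel D p).

Let u1n x : u1 x != 0. Proof. by rewrite gt_eqF// (warped_pos1 W). Qed.
Let u2n x : u2 x != 0. Proof. by rewrite gt_eqF// (warped_pos2 W). Qed.
Let pp := mem_chart_dom p.
Let Wc := warped_chartC W.

Let sGam I J K : smooth_fun_on (chart_dom p) (Gam I J K).
Proof. exact: smooth_christoffel (lc_connection lcD) _ _ _ _. Qed.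

(** V inverts G2 at p only: equations are solved for the Christoffel symbols or
    their derivatives after having been differentiated. *)
Variable V : 'I_n2 -> 'I_n2 -> R.
Hypothesis VE : forall e d, \sum_c G2 e c p * V c d = (e == d)%:R.

Let solve2 (y r : 'I_n2 -> R) :
  (forall c, \sum_b G2 b c p * y b = r c) ->
  forall d, y d = \sum_c r c * V c d.
Proof.
move=> E d; under eq_bigr do rewrite -E mulr_suml.
rewrite exchange_big /= -[LHS](sum_delta y d); apply: eq_bigr => b _.
by rewrite -VE mulr_sumr; apply: eq_bigr => c _; ring.
Qed.

Let du a := partial p (s2 a) u1 p.
Let ddu a c := partial p (s2 a) (partial p (s2 c) u1) p.
Let hess2 a c := ddu a c - \sum_e c2 a c e p * du e.
Let norm2 := \sum_c \sum_a V c a * (du a * du c).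
Let lap2 := \sum_c \sum_a V c a * hess2 a c.
Let hess1 j k := partial p (s1 j) (partial p (s1 k) u2) p
  - \sum_l c1 j k l p * partial p (s1 l) u2 p.

Section Normal.
Variables (j k : 'I_n1).
Let t a x := Gam (s1 j) (s1 k) (s2 a) x.

(** By [warped_christoffel112], t is a multiple of the gradient of u1. *)
Let t_du : \sum_a t a p * du a = - (u1 p / u2 p ^+ 2 * G1 j k p * norm2).
Proof.
have E d : u2 p ^+ 2 * t d p = \sum_c (- (u1 p * du c * G1 j k p)) * V c d.
  apply: (@solve2 (fun d => u2 p ^+ 2 * t d p)
    (fun c => - (u1 p * du c * G1 j k p))) => c.
  rewrite -(warped_christoffel112 W j k c pp) mulr_sumr.
  by apply: eq_bigr => b _; rewrite mulrCA.
have u22 : u2 p ^+ 2 != 0 by rewrite expf_neq0.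
apply: (mulfI u22); rewrite mulr_sumr.
transitivity (\sum_a \sum_c - (u1 p * G1 j k p) * (V c a * (du a * du c))).
  apply: eq_bigr => a _; rewrite mulrA E mulr_suml.
  by apply: eq_bigr => c _; ring.
rewrite exchange_big /norm2 /=.
under eq_bigr do rewrite -mulr_sumr.
by rewrite -mulr_sumr; field; exact: u2n.
Qed.

(** The left-hand side is the divergence of t along the second block. It follows
    from [warped_christoffel112] by differentiation, metric compatibility
    turning the derivative of G2 into Christoffel symbols. *)
Let t_div : \sum_a (partial p (s2 a) (t a) p + \sum_b t b p * c2 a b a p) =
  - (G1 j k p / u2 p ^+ 2 * (norm2 + u1 p * lap2)).
Proof.
have su1 := warped_smooth1 W; have su2 := warped_smooth2 W.
have sG1 := block_smooth (warped_block1 W) j k.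
have sG2 b c := block_smooth (warped_block2 W) b c.
have st b : smooth_fun_on (chart_dom p) (t b) by exact: sGam.
have sdu c : smooth_fun_on (chart_dom p) (partial p (s2 c) u1).
  exact: partial_smooth.
have sGt b c : smooth_fun_on (chart_dom p) (fun y => G2 b c y * t b y).
  exact: smooth_funM.
have dT a c : u2 p ^+ 2 * \sum_b (G2 b c p * partial p (s2 a) (t b) p
      + t b p * partial p (s2 a) (G2 b c) p) =
    - ((u1 p * ddu a c + du c * du a) * G1 j k p).
  have E0 y : chart_dom p y -> (u2 y * u2 y) * \sum_b G2 b c y * t b y =
      -1 * ((u1 y * partial p (s2 c) u1 y) * G1 j k y).
    by move=> py; rewrite -expr2 (warped_christoffel112 W j k c py) mulN1r.
  have := @partial_near _ _ _ p (chart_dom p)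
    (fun y => (u2 y * u2 y) * \sum_b G2 b c y * t b y)
    (fun y => -1 * ((u1 y * partial p (s2 c) u1 y) * G1 j k y)) p (s2 a) op pp.
  rewrite (partialM _ _ pp (smooth_funM op su2 su2)
    (smooth_fun_sum op (fun b => sGt b c))).
  rewrite (partialM _ _ pp su2 su2) (warped_partial_u2 W)//.
  rewrite (partial_sum _ _ pp (fun b => sGt b c)).
  have sud := smooth_funM op su1 (sdu c).
  rewrite (partialZ _ _ _ pp (smooth_funM op sud sG1)).
  rewrite (partialM _ _ pp sud sG1) (partialM _ _ pp su1 (sdu c)).
  rewrite (warped_partial_G1 W)// -/(du a) -/(du c) -/(ddu a c) => E.
  have {}E := E E0.
  transitivity (-1 * (u1 p * partial p (s2 c) u1 p * 0 + G1 j k p *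
    (u1 p * ddu a c + du c * du a))); last by ring.
  rewrite -E expr2 !mulr0 addr0 mulr0 addr0; congr (_ * _).
  by apply: eq_bigr => b _; rewrite (partialM _ _ pp (sG2 b c) (st b)).
have E a d : u2 p ^+ 2 * (partial p (s2 a) (t d) p + \sum_b c2 a b d p * t b p) =
    \sum_c (- (G1 j k p * (du a * du c + u1 p * hess2 a c))) * V c d.
  apply: (@solve2 (fun d => u2 p ^+ 2 * (partial p (s2 a) (t d) p
    + \sum_b c2 a b d p * t b p))
    (fun c => - (G1 j k p * (du a * du c + u1 p * hess2 a c)))) => c.
  transitivity (u2 p ^+ 2 * \sum_b (G2 b c p * partial p (s2 a) (t b) p
      + t b p * partial p (s2 a) (G2 b c) p)
    - \sum_e c2 a c e p * (u2 p ^+ 2 * \sum_b G2 b e p * t b p)).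
    have -> : \sum_b (G2 b c p * partial p (s2 a) (t b) p
        + t b p * partial p (s2 a) (G2 b c) p) =
      \sum_b G2 b c p * partial p (s2 a) (t b) p
      + \sum_b G2 b c p * \sum_e c2 a e b p * t e p
      + \sum_e c2 a c e p * \sum_b G2 b e p * t b p.
      rewrite big_split /= -addrA; congr (_ + _).
      under eq_bigr do rewrite (block_compatible (warped_block2 W) _ _ _ pp) mulrDr.
      rewrite big_split /=; congr (_ + _).
        under eq_bigr do rewrite mulr_sumr; rewrite exchange_big /=.
        apply: eq_bigr => b _; rewrite mulr_sumr; apply: eq_bigr => e _.
        by ring.
      under eq_bigr do rewrite mulr_sumr; rewrite exchange_big /=.
      apply: eq_bigr => b _; rewrite mulr_sumr; apply: eq_bigr => e _.
      by ring.
    have -> : \sum_e c2 a c e p * (u2 p ^+ 2 * \sum_b G2 b e p * t b p) =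
        u2 p ^+ 2 * \sum_e c2 a c e p * \sum_b G2 b e p * t b p.
      by rewrite mulr_sumr; apply: eq_bigr => e _; rewrite mulrCA.
    rewrite [X in _ = X - _]mulrDr addrK -big_split mulr_sumr /=.
    by apply: eq_bigr => b _; ring.
  rewrite dT; under eq_bigr do rewrite (warped_christoffel112 W j k _ pp).
  rewrite /hess2 -/(du _).
  have -> : \sum_e c2 a c e p * - (u1 p * partial p (s2 e) u1 p * G1 j k p) =
      - (u1 p * G1 j k p * \sum_e c2 a c e p * du e).
    by rewrite mulr_sumr -sumrN; apply: eq_bigr => e _; rewrite /du; ring.
  by ring.
have u22 : u2 p ^+ 2 != 0 by rewrite expf_neq0.
apply: (mulfI u22); rewrite mulr_sumr.
transitivity (\sum_a \sum_c - G1 j k p *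
    (V c a * (du a * du c) + u1 p * (V c a * hess2 a c))).
  apply: eq_bigr => a _; have := E a a.
  under [X in _ * (_ + X) = _ -> _]eq_bigr do rewrite mulrC.
  by move=> ->; apply: eq_bigr => c _; ring.
rewrite exchange_big /norm2 /lap2 /=.
under eq_bigr do rewrite -mulr_sumr big_split /= -mulr_sumr.
by rewrite -mulr_sumr big_split /= -mulr_sumr; field; exact: u2n.
Qed.

(** The indices of the trace in the first block give the Ricci tensor of the
    first factor and n1 - 1 products of t with the logarithmic derivative of u1
    (the sum A). Those in the second block (the sum B) give the divergence of t
    and n2 times the Hessian of u2, and one more product of t with the
    logarithmic derivative of u1, which cancels the part of the divergence of t
    quadratic in the derivative of u1. *)
Lemma warped_ricci11 :
  ricci D p (delta_mx 0 (s1 j)) (delta_mx 0 (s1 k)) =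
  ricci_coord (fun i j k => c1 i j k p)
    (fun m i j k => partial p (s1 m) (c1 i j k) p) j k
  - ((n1%:R - 1) * norm2 + u1 p * lap2) / u2 p ^+ 2 * G1 j k p
  - n2%:R / u2 p * hess1 j k.
Proof.
pose nu a := du a / u1 p.
pose psi i := partial p (s1 i) u2 p / u2 p.
have G111 a b c x (px : chart_dom p x) := warped_christoffel111 W a b c px.
have G121 i a l : Gam (s1 i) (s2 a) (s1 l) p = nu a * (i == l)%:R.
  exact: (warped_christoffel121 W).
have G211 a i l : Gam (s2 a) (s1 i) (s1 l) p = nu a * (i == l)%:R.
  by rewrite (christoffel_sym lcD)// G121.
have P111 m a b c : partial p (s1 m) (Gam (s1 a) (s1 b) (s1 c)) p =
    partial p (s1 m) (c1 a b c) p.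
  by apply: (partial_near _ _ op pp) => x px; exact: G111.
have G222 a b c : Gam (s2 a) (s2 b) (s2 c) p = c2 a b c p.
  exact: (warped_christoffel111 Wc).
have G212 a i b : Gam (s2 a) (s1 i) (s2 b) p = psi i * (a == b)%:R.
  exact: (warped_christoffel121 Wc).
have G122 i a b : Gam (s1 i) (s2 a) (s2 b) p = psi i * (a == b)%:R.
  by rewrite (christoffel_sym lcD)// G212.
have dpsi a : partial p (s1 j) (Gam (s2 a) (s1 k) (s2 a)) p =
    (partial p (s1 j) (partial p (s1 k) u2) p
     - psi k * partial p (s1 j) u2 p) / u2 p.
  have su2 := warped_smooth2 W.
  have := @partial_near _ _ _ p (chart_dom p)
    (fun y => Gam (s2 a) (s1 k) (s2 a) y * u2 y) (partial p (s1 k) u2) p (s1 j) op pp.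
  rewrite (partialM _ _ pp (sGam _ _ _) su2) G212 eqxx mulr1 => <-.
    by rewrite addrC addKr; field; exact: u2n.
  move=> y py; rewrite (warped_christoffel121 Wc)// eqxx mulr1 divfK//.
have A : \sum_i (partial p (s1 i) (Gam (s1 j) (s1 k) (s1 i)) p
      - partial p (s1 j) (Gam (s1 i) (s1 k) (s1 i)) p
      + \sum_m (Gam (s1 j) (s1 k) m p * Gam (s1 i) m (s1 i) p
                - Gam (s1 i) (s1 k) m p * Gam (s1 j) m (s1 i) p)) =
    ricci_coord (fun i j k => c1 i j k p)
      (fun m i j k => partial p (s1 m) (c1 i j k) p) j k
    + (n1%:R - 1) * \sum_a t a p * nu a.
  pose q i := \sum_a Gam (s1 i) (s1 k) (s2 a) p * nu a.
  transitivity (\sum_i ((partial p (s1 i) (c1 j k i) p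
      - partial p (s1 j) (c1 i k i) p
      + \sum_m (c1 j k m p * c1 i m i p - c1 i k m p * c1 j m i p))
      + q j * (i == i)%:R - q i * (j == i)%:R)).
    apply: eq_bigr => i _; rewrite !P111 -!addrA; congr (_ + (_ + _)).
    rewrite (warped_sum W); congr (_ + _).
      by apply: eq_bigr => l _; rewrite !G111.
    rewrite /q !mulr_suml -sumrB; apply: eq_bigr => a _.
    by rewrite !G121; ring.
  rewrite sumrB big_split /= -mulr_sumr sum_eqxx (sum_deltaC q).
  rewrite [X in _ = _ + _ * X](_ : _ = q j)// /ricci_coord.
  by rewrite mulrBl mul1r [_ * n1%:R]mulrC addrA.
have B : \sum_a (partial p (s2 a) (Gam (s1 j) (s1 k) (s2 a)) p
      - partial p (s1 j) (Gam (s2 a) (s1 k) (s2 a)) p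
      + \sum_m (Gam (s1 j) (s1 k) m p * Gam (s2 a) m (s2 a) p
                - Gam (s2 a) (s1 k) m p * Gam (s1 j) m (s2 a) p)) =
    \sum_a (partial p (s2 a) (t a) p + \sum_b t b p * c2 a b a p)
    - \sum_a t a p * nu a - n2%:R / u2 p * hess1 j k.
  pose z := \sum_l c1 j k l p * psi l.
  transitivity (\sum_a ((partial p (s2 a) (t a) p + \sum_b t b p * c2 a b a p)
      - t a p * nu a - hess1 j k / u2 p * (a == a)%:R)).
    apply: eq_bigr => a _; rewrite dpsi (warped_sum W).
    have -> : \sum_l (Gam (s1 j) (s1 k) (s1 l) p * Gam (s2 a) (s1 l) (s2 a) p
         - Gam (s2 a) (s1 k) (s1 l) p * Gam (s1 j) (s1 l) (s2 a) p) =
        z - t a p * nu a.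
      rewrite sumrB; congr (_ - _).
        by apply: eq_bigr => l _; rewrite G111// G212 eqxx mulr1.
      rewrite -(sum_deltaC (fun l => Gam (s1 j) (s1 l) (s2 a) p * nu a) k).
      by apply: eq_bigr => l _; rewrite G211; ring.
    have -> : \sum_b (Gam (s1 j) (s1 k) (s2 b) p * Gam (s2 a) (s2 b) (s2 a) p
         - Gam (s2 a) (s1 k) (s2 b) p * Gam (s1 j) (s2 b) (s2 a) p) =
        \sum_b t b p * c2 a b a p - psi k * psi j.
      rewrite sumrB; congr (_ - _).
        by apply: eq_bigr => b _; rewrite G222.
      transitivity (psi k * psi j * (a == a)%:R); last by rewrite eqxx mulr1.
      rewrite -(sum_deltaC (fun b => psi k * psi j * (b == a)%:R) a).
      by apply: eq_bigr => b _; rewrite G212 G122; ring.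
    have -> : hess1 j k = partial p (s1 j) (partial p (s1 k) u2) p - z * u2 p.
      rewrite /hess1 /z mulr_suml; congr (_ - _); apply: eq_bigr => l _.
      by rewrite /psi -mulrA divfK.
    by rewrite eqxx mulr1 /psi; field; exact: u2n.
  by rewrite !sumrB -mulr_sumr sum_eqxx mulrC mulrAC mulrA.
rewrite (ricci_christoffel (lc_connection lcD)) (warped_sum W) A B t_div.
have -> : \sum_a t a p * nu a = (\sum_a t a p * du a) / u1 p.
  by rewrite mulr_suml; apply: eq_bigr => a _; rewrite /nu mulrA.
by rewrite t_du; field; rewrite u1n u2n.
Qed.

End Normal.

End RicciBlock.

End Christoffel.
End WarpedChart.

(** * The product of two manifolds *)

Section ProductManifold.
Context {R : realType} {n1 n2 : nat}.
Context {B : smoothManifold R n1} {F : smoothManifold R n2}.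
Local Notation M := (prod_manifold B F).
Implicit Types (x y p : M).

Lemma tder_fst (u : B -> R) x v :
  tder (fun y : M => u y.1) x v = tder u x.1 (lsubmx v).
Proof.
rewrite /tder /derive; set a := (X in lim (X @ _)); set b := (X in _ = lim (X @ _)).
suff -> : a = b by [].
apply/funext => t; rewrite /a /b /= /prod_chart.
by rewrite linearP /= row_mxKl.
Qed.

Lemma tder_snd (u : F -> R) x v :
  tder (fun y : M => u y.2) x v = tder u x.2 (rsubmx v).
Proof.
rewrite /tder /derive; set a := (X in lim (X @ _)); set b := (X in _ = lim (X @ _)).
suff -> : a = b by [].
apply/funext => t; rewrite /a /b /= /prod_chart.
by rewrite linearP /= row_mxKr.
Qed.

Lemma smooth_fst (U : set B) (u : B -> R) : open U -> smooth_fun_on U u ->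
  smooth_fun_on [set y : M | U y.1] (fun y : M => u y.1).
Proof.
move=> oU su c k.
have -> : [set y : M | U y.1] `&` chart_dom c =
    (U `&` chart_dom c.1) `*` chart_dom c.2.
  by apply/seteqP; split => [[y z] [/= ? [/= ? ?]]|[y z] [/= [? ?] ?]].
rewrite prod_chart_image; set W := [set z | _].
have oW : open W.
  apply: open_hsubmx; last exact: chart_img_open.
  exact: open_chart_imgI.
apply: (@Ck_on_comp_linear _ _ _ _ lsubmx _ W (u \o chart_inv c.1)) (su c.1 k) => //.
- exact: continuous_lsubmx.
- by move=> z [].
move=> l; case: (split_ordP l) => m ->; [right; exists m|left];
  by apply/matrixP => a b; rewrite !mxE eq_shift ?andbF.
Qed.

Lemma smooth_snd (U : set F) (u : F -> R) : open U -> smooth_fun_on U u ->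
  smooth_fun_on [set y : M | U y.2] (fun y : M => u y.2).
Proof.
move=> oU su c k.
have -> : [set y : M | U y.2] `&` chart_dom c =
    chart_dom c.1 `*` (U `&` chart_dom c.2).
  by apply/seteqP; split => [[y z] [/= ? [/= ? ?]]|[y z] [/= ? [? ?]]].
rewrite prod_chart_image; set W := [set z | _].
have oW : open W.
  apply: open_hsubmx; first exact: chart_img_open.
  exact: open_chart_imgI.
apply: (@Ck_on_comp_linear _ _ _ _ rsubmx _ W (u \o chart_inv c.2)) (su c.2 k) => //.
- exact: continuous_rsubmx.
- by move=> z [].
move=> l; case: (split_ordP l) => m ->; [left|right; exists m];
  by apply/matrixP => a b; rewrite !mxE eq_shift ?andbF.
Qed.

Lemma coframe_lshift p k x v :
  coframe p (lshift n2 k) x v = coframe p.1 k x.1 (lsubmx v).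
Proof.
rewrite coframe.unlock -tder_fst; congr (tder _ _ _); apply/funext => y.
by rewrite /= /prod_chart row_mxEl.
Qed.

Lemma coframe_rshift p a x v :
  coframe p (rshift n1 a) x v = coframe p.2 a x.2 (rsubmx v).
Proof.
rewrite coframe.unlock -tder_snd; congr (tder _ _ _); apply/funext => y.
by rewrite /= /prod_chart row_mxEr.
Qed.

(** The frame of a product chart consists of the lifts of the frames of the
    factors, since the coframes match. *)
Lemma frame_lshift p i x : chart_dom p x ->
  frame p (lshift n2 i) x = row_mx (frame p.1 i x.1) 0.
Proof.
move=> px; have [p1 p2] := px.
rewrite [RHS](frame_decomposition _ px) big_split_ord /=.
rewrite [X in _ = _ + X]big1 => [|a _]; last first.
  by rewrite coframe_rshift row_mxKr coframe0 scale0r.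
rewrite addr0 (bigD1 i)//= big1 => [|k ki].
  by rewrite coframe_lshift row_mxKl coframe_frame// eqxx scale1r addr0.
by rewrite coframe_lshift row_mxKl coframe_frame// (negPf ki) scale0r.
Qed.

Lemma frame_rshift p a x : chart_dom p x ->
  frame p (rshift n1 a) x = row_mx 0 (frame p.2 a x.2).
Proof.
move=> px; have [p1 p2] := px.
rewrite [RHS](frame_decomposition _ px) big_split_ord /=.
rewrite [X in _ = X + _]big1 => [|i _]; last first.
  by rewrite coframe_lshift row_mxKl coframe0 scale0r.
rewrite add0r (bigD1 a)//= big1 => [|k ka].
  by rewrite coframe_rshift row_mxKr coframe_frame// eqxx scale1r addr0.
by rewrite coframe_rshift row_mxKr coframe_frame// (negPf ka) scale0r.
Qed.

Lemma partial_lshift_fst p (u : B -> R) i x : chart_dom p x ->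
  partial p (lshift n2 i) (fun y : M => u y.1) x = partial p.1 i u x.1.
Proof. by move=> px; rewrite partial.unlock tder_fst frame_lshift// row_mxKl. Qed.

Lemma partial_rshift_fst p (u : B -> R) a x : chart_dom p x ->
  partial p (rshift n1 a) (fun y : M => u y.1) x = 0.
Proof. by move=> px; rewrite partial.unlock tder_fst frame_rshift// row_mxKl tder0. Qed.

Lemma partial_lshift_snd p (u : F -> R) i x : chart_dom p x ->
  partial p (lshift n2 i) (fun y : M => u y.2) x = 0.
Proof. by move=> px; rewrite partial.unlock tder_snd frame_lshift// row_mxKr tder0. Qed.

Lemma partial_rshift_snd p (u : F -> R) a x : chart_dom p x ->
  partial p (rshift n1 a) (fun y : M => u y.2) x = partial p.2 a u x.2.
Proof. by move=> px; rewrite partial.unlock tder_snd frame_rshift// row_mxKr. Qed.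

Lemma delta_lshift i : delta_mx 0 (lshift n2 i) = row_mx (delta_mx 0 i) 0 :> 'rV[R]_(n1 + n2).
Proof.
apply/rowP => j; case: (split_ordP j) => k ->;
  by rewrite ?row_mxEl ?row_mxEr !mxE eq_shift.
Qed.

Lemma delta_rshift a : delta_mx 0 (rshift n1 a) = row_mx 0 (delta_mx 0 a) :> 'rV[R]_(n1 + n2).
Proof.
apply/rowP => j; case: (split_ordP j) => k ->;
  by rewrite ?row_mxEl ?row_mxEr !mxE eq_shift.
Qed.

(** The lift of P acts on u by the components of P, functions on B, and by
    partial derivatives of u. *)
Lemma smooth_liftB (P : vfield B) : smooth_vfield_on setT P ->
  smooth_vfield_on setT (liftB P : vfield M).
Proof.
move=> sP U u oU _ su; apply: smooth_fun_local => c Uc.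
pose V := U `&` chart_dom c.
have oV : open V by apply: openI => //; exact: chart_dom_open.
have VU : V `<=` U by move=> y [].
have Vc : V `<=` chart_dom c by move=> y [].
exists V; first by split=> //; exact: mem_chart_dom.
have suV := smooth_fun_sub VU su.
have sPc k : smooth_fun_on V (fun y : M => coframe c.1 k y.1 (P y.1)).
  have o1 := @chart_dom_open _ _ _ c.1.
  apply: smooth_fun_sub (smooth_fst o1 (smooth_coframe k o1 (@subset_refl _ _)
    (smooth_vfield_sub (@subsetT _ _) sP))).
  by move=> y [_ []].
apply: (@smooth_fun_eq _ _ _ _ (fun y : M => \sum_k
    coframe c.1 k y.1 (P y.1) * partial c (lshift n2 k) u y)) => //.
  move=> y Vy; rewrite (frame_decomposition (liftB P y) (Vc y Vy)).
  rewrite (tder_partial _ _ Vy suV) big_split_ord /=.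
  rewrite [X in _ = _ + X]big1 => [|a _]; last first.
    by rewrite coframe_rshift row_mxKr coframe0 mul0r.
  rewrite addr0; apply: eq_bigr => k _.
  by rewrite coframe_lshift row_mxKl.
apply: smooth_fun_sum => // k; apply: smooth_funM => //.
exact: partial_smooth.
Qed.

Section Metric.
Variables (gB : bilin_field B) (gF : bilin_field F).
Hypothesis gB_riem : riemannian_metric gB.
Hypothesis gF_riem : riemannian_metric gF.
Variables (h : B -> R) (f : F -> R).
Hypothesis h_smooth : smooth_fun_on setT h.
Hypothesis f_smooth : smooth_fun_on setT f.
Hypothesis h_pos : forall y : B, 0 < h y.
Hypothesis f_pos : forall y : F, 0 < f y.
Let g := dwp_metric gB gF f h.

Lemma smooth_fM (U : set M) : smooth_fun_on U (fun y : M => f y.2).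
Proof. by apply: smooth_fun_sub (smooth_snd openT f_smooth). Qed.

Lemma smooth_hM (U : set M) : smooth_fun_on U (fun y : M => h y.1).
Proof. by apply: smooth_fun_sub (smooth_fst openT h_smooth). Qed.

Lemma smooth_gcoefB (p : M) i j :
  smooth_fun_on (chart_dom p) (fun y : M => gcoef gB p.1 i j y.1).
Proof.
have := smooth_fst (@chart_dom_open _ _ _ p.1) (smooth_gcoef gB_riem p.1 i j).
by apply: smooth_fun_sub => y [].
Qed.

Lemma smooth_gcoefF (p : M) i j :
  smooth_fun_on (chart_dom p) (fun y : M => gcoef gF p.2 i j y.2).
Proof.
have := smooth_snd (@chart_dom_open _ _ _ p.2) (smooth_gcoef gF_riem p.2 i j).
by apply: smooth_fun_sub => y [].
Qed.

Lemma dwp_riemannian : riemannian_metric g.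
Proof.
split.
- move=> x a u v w; rewrite /g /dwp_metric !linearP.
  by rewrite (metric_linear gB_riem) (metric_linear gF_riem); ring.
- move=> x u v; rewrite /g /dwp_metric.
  by rewrite (Defs.metric_sym gB_riem) (Defs.metric_sym gF_riem).
- move=> x u u0; rewrite /g /dwp_metric.
  have posB w : 0 <= gB x.1 w w.
    have [->|/(Defs.metric_pos gB_riem x.1)/ltW//] := eqVneq w 0.
    by rewrite (metric0l gB_riem).
  have posF w : 0 <= gF x.2 w w.
    have [->|/(Defs.metric_pos gF_riem x.2)/ltW//] := eqVneq w 0.
    by rewrite (metric0l gF_riem).
  have f0 : 0 < f x.2 ^+ 2 by rewrite exprn_gt0.
  have h0 : 0 < h x.1 ^+ 2 by rewrite exprn_gt0.
  have [l0|l0] := eqVneq (lsubmx u) 0; last first.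
    apply: ltr_wpDr; first by rewrite mulr_ge0// ltW.
    by rewrite mulr_gt0//; exact: (Defs.metric_pos gB_riem).
  apply: ltr_wpDl; first by rewrite mulr_ge0// ltW.
  rewrite mulr_gt0//.
  apply: (Defs.metric_pos gF_riem); apply: contraNN u0 => /eqP r0.
  by rewrite -[u]hsubmxK l0 r0 row_mx0.
move=> U X Y oU sX sY; apply: smooth_fun_local => c Uc.
pose V := U `&` chart_dom c.
have oV : open V by apply: openI => //; exact: chart_dom_open.
have VU : V `<=` U by move=> y [].
have Vc : V `<=` chart_dom c by move=> y [].
exists V; first by split=> //; exact: mem_chart_dom.
have sc Z k : smooth_vfield_on U Z -> smooth_fun_on V (fun y => coframe c k y (Z y)).
  by move=> sZ; apply: smooth_coframe => //; exact: smooth_vfield_sub sZ.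
apply: (@smooth_fun_eq _ _ _ _ (fun y : M =>
  (f y.2 * f y.2) * (\sum_i \sum_j (coframe c (lshift n2 i) y (X y) *
     (coframe c (lshift n2 j) y (Y y) * gcoef gB c.1 i j y.1)))
  + (h y.1 * h y.1) * (\sum_i \sum_j (coframe c (rshift n1 i) y (X y) *
     (coframe c (rshift n1 j) y (Y y) * gcoef gF c.2 i j y.2))))) => //.
  move=> y /Vc[yc1 yc2]; rewrite /g /dwp_metric -!expr2.
  rewrite (frame_decomposition (lsubmx (X y)) yc1) (metric_suml gB_riem).
  rewrite (frame_decomposition (rsubmx (X y)) yc2) (metric_suml gF_riem).
  congr (_ * _ + _ * _); apply: eq_bigr => i _.
    rewrite (frame_decomposition (lsubmx (Y y)) yc1) (metric_sumr gB_riem).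
    rewrite mulr_sumr; apply: eq_bigr => j _.
    by rewrite !coframe_lshift.
  rewrite (frame_decomposition (rsubmx (Y y)) yc2) (metric_sumr gF_riem).
  rewrite mulr_sumr; apply: eq_bigr => j _.
  by rewrite !coframe_rshift.
have sfM := smooth_fM V; have shM := smooth_hM V.
apply: smooth_funD => //; apply: smooth_funM => //; do ?exact: smooth_funM.
  apply: smooth_fun_sum => // i; apply: smooth_fun_sum => // j.
  apply: smooth_funM => //; first exact: sc.
  apply: smooth_funM => //; first exact: sc.
  exact: smooth_fun_sub Vc (@smooth_gcoefB c i j).
apply: smooth_fun_sum => // i; apply: smooth_fun_sum => // j.
apply: smooth_funM => //; first exact: sc.
apply: smooth_funM => //; first exact: sc.
exact: smooth_fun_sub Vc (@smooth_gcoefF c i j).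
Qed.

Lemma dwp_metricBB x u v :
  g x (row_mx u 0) (row_mx v 0) = f x.2 ^+ 2 * gB x.1 u v.
Proof. by rewrite /g /dwp_metric !row_mxKl !row_mxKr (metric0l gF_riem) mulr0 addr0. Qed.

Lemma dwp_metricFF x u v :
  g x (row_mx 0 u) (row_mx 0 v) = h x.1 ^+ 2 * gF x.2 u v.
Proof. by rewrite /g /dwp_metric !row_mxKl !row_mxKr (metric0l gB_riem) mulr0 add0r. Qed.

Lemma dwp_metricBF x u v : g x (row_mx u 0) (row_mx 0 v) = 0.
Proof.
rewrite /g /dwp_metric !row_mxKl !row_mxKr (metric0l gF_riem).
by rewrite (Defs.metric_sym gB_riem) (metric0l gB_riem) !mulr0 addr0.
Qed.

Lemma dwp_warped_chart (DB : covder B) (DF : covder F) p :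
  levi_civita gB DB -> levi_civita gF DF ->
  warped_chart p g (@lshift n1 n2) (@rshift n1 n2)
    (fun y => f y.2) (fun y => h y.1)
    (fun i j y => gcoef gB p.1 i j y.1) (fun a b y => gcoef gF p.2 a b y.2)
    (fun i j k y => christoffel DB p.1 i j k y.1)
    (fun a b c y => christoffel DF p.2 a b c y.2).
Proof.
move=> lcB lcF; split.
- by move=> E; rewrite big_split_ord.
- split=> [i j|i j y|i j k y []|a b y []|i j k y py].
  + exact: smooth_gcoefB.
  + exact: gcoef_sym.
  + by move=> *; exact: (christoffel_sym lcB).
  + by move=> py _; exact: (gcoef_nondegenerate gB_riem).
  + rewrite (partial_lshift_fst (gcoef gB p.1 j k))//.
    by case: py => *; exact: (gcoef_compatible gB_riem lcB).
- split=> [i j|i j y|i j k y []|a b y []|i j k y py].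
  + exact: smooth_gcoefF.
  + exact: gcoef_sym.
  + by move=> *; exact: (christoffel_sym lcF).
  + by move=> _ py; exact: (gcoef_nondegenerate gF_riem).
  + rewrite (partial_rshift_snd (gcoef gF p.2 j k))//.
    by case: py => *; exact: (gcoef_compatible gF_riem lcF).
- by [].
- by [].
- exact: smooth_fM.
- exact: smooth_hM.
- by move=> i j y py; rewrite /gcoef !frame_lshift// dwp_metricBB.
- by move=> i j y py; rewrite /gcoef !frame_rshift// dwp_metricFF.
- by move=> i a y py; rewrite /gcoef frame_lshift// frame_rshift// dwp_metricBF.
- move=> i a y py; rewrite (gcoef_sym dwp_riemannian) /gcoef.
  by rewrite frame_lshift// frame_rshift// dwp_metricBF.
- by move=> i y py; exact: (partial_lshift_snd f).
- by move=> i y py; exact: (partial_rshift_fst h).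
- by move=> a i j y py; exact: (partial_rshift_fst (gcoef gB p.1 i j)).
- by move=> a i j y py; exact: (partial_lshift_snd (gcoef gF p.2 i j)).
Qed.

End Metric.
End ProductManifold.

(** * Homotheties, gradients and divergences *)

Section Rescaling.
Context {R : realType} {n : nat} {M : smoothManifold R n}.
Variables (g : bilin_field M) (gR : riemannian_metric g) (c : R) (c0 : 0 < c).

Lemma scaled_riemannian : riemannian_metric (fun x u v => c * g x u v).
Proof.
split=> [x a u v w|x u v|x u u0|U X Y oU sX sY].
- by rewrite (metric_linear gR); ring.
- by rewrite (Defs.metric_sym gR).
- by rewrite mulr_gt0//; exact: Defs.metric_pos gR _ _ u0.
- apply: (smooth_funM oU (@smooth_fun_cst _ _ _ U c)).
  exact: (metric_smooth gR oU sX sY).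
Qed.

(** A constant factor comes out of the derivative in the metric axiom. *)
Lemma scaled_levi_civita D : levi_civita g D ->
  levi_civita (fun x u v => c * g x u v) D.
Proof.
move=> lcD; split; first exact: lc_connection lcD.
  exact: lc_torsion_free lcD.
move=> U X Y Z p oU Up sX sY sZ.
have sg := metric_smooth gR oU sY sZ.
rewrite (tderM Up _ (@smooth_fun_cst _ _ _ U c) sg) tder_cst mulr0 addr0.
by rewrite (lc_metric lcD oU Up sX sY sZ) mulrDr.
Qed.

Lemma metric_trace_scaled x T :
  metric_trace (fun u v => c * g x u v) T = metric_trace (g x) T / c.
Proof.
rewrite /metric_trace.
have -> : gram (fun u v => c * g x u v) = c *: gram (g x).
  by apply/matrixP => i j; rewrite !mxE.
have -> : invmx (c *: gram (g x)) = c^-1 *: invmx (gram (g x)).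
  rewrite invmxZ// unitmxZ ?gram_unit// unitfE gt_eqF//.
by rewrite -scalemxAl mxtraceZ mulrC.
Qed.

(** The gradient w satisfies g(v, w) = v(u), so this is [metric_trace_square]. *)
Lemma grad_norm u x :
  g x (grad g u x) (grad g u x) =
  metric_trace (g x) (fun v w => tder u x v * tder u x w).
Proof.
rewrite -(metric_trace_square gR); apply: metric_trace_eq => j k.
have E i : g x (delta_mx 0 i) (grad g u x) = tder u x (delta_mx 0 i).
  rewrite (Defs.metric_sym gR) (gramE gR) /grad -mulmxA mulmxA mulmxKV; last exact: gram_unit.
  by rewrite trmx_delta -colE !mxE.
by rewrite !E.
Qed.

(** If the rows of E are an orthonormal frame and G is the Gram matrix, then
    E G E^T = 1, hence G E^T E = 1, which disappears under the trace. *)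
Lemma divergence_trace D (X : vfield M) x (e : 'I_n -> 'rV[R]_n) :
  connection D -> smooth_vfield_on setT X -> orthonormal_frame (g x) e ->
  divergence g D X x e = \tr (lin1_mx (fun u => D x u X)).
Proof.
move=> conD sX oe; pose E : 'M[R]_n := \matrix_i e i.
set A := lin1_mx _.
have EGE : E *m gram (g x) *m E^T = 1%:M.
  apply/matrixP => i j; rewrite [RHS]mxE -oe (gramE gR) [LHS]mxE [RHS]mxE.
  apply: eq_bigr => k _; rewrite ![_^T _ _]mxE [E j k]mxE; congr (_ * _).
  by rewrite !mxE; apply: eq_bigr => l _; rewrite !mxE.
have {}EGE : gram (g x) *m (E^T *m E) = 1%:M.
  by rewrite mulmxA; apply: mulmx1C; rewrite mulmxA.
have DA u : D x u X = u *m A.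
  rewrite {1}(row_sum_delta u) (covder_sumv conD _ _ openT I sX).
  apply/rowP => k; rewrite summxE mxE; apply: eq_bigr => i _.
  by rewrite !mxE.
rewrite -[A]mulmx1 -EGE mulmxA mulmxA mxtrace_mulC !mulmxA /mxtrace.
apply: eq_bigr => i _; rewrite DA (gramE gR) [LHS]mxE [RHS]mxE.
apply: eq_bigr => k _; rewrite ![_^T _ _]mxE [E i k]mxE; congr (_ * _).
rewrite !mxE; apply: eq_bigr => l _; congr (_ * _).
by rewrite !mxE; apply: eq_bigr => m _; rewrite !mxE.
Qed.

End Rescaling.

(** * Curvature of the doubly warped product *)

Section DoublyWarpedProduct.
Context {R : realType} {n1 n2 : nat}.
Context {B : smoothManifold R n1} {F : smoothManifold R n2}.
Local Notation M := (prod_manifold B F).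
Variables (gB : bilin_field B) (gF : bilin_field F).
Hypothesis gB_riem : riemannian_metric gB.
Hypothesis gF_riem : riemannian_metric gF.
Variables (h : B -> R) (f : F -> R).
Hypothesis h_smooth : smooth_fun_on setT h.
Hypothesis f_smooth : smooth_fun_on setT f.
Hypothesis h_pos : forall y : B, 0 < h y.
Hypothesis f_pos : forall y : F, 0 < f y.
Let g : bilin_field M := dwp_metric gB gF f h.
Let gR : riemannian_metric g.
Proof. exact: dwp_riemannian. Qed.

Lemma metric_trace_dwp (x : M) T :
  metric_trace (g x) T =
    metric_trace (gB x.1) (fun u v => T (row_mx u 0) (row_mx v 0)) / f x.2 ^+ 2
  + metric_trace (gF x.2) (fun u v => T (row_mx 0 u) (row_mx 0 v)) / h x.1 ^+ 2.
Proof.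
have f2 : f x.2 ^+ 2 != 0 by rewrite gt_eqF// exprn_gt0.
have h2 : h x.1 ^+ 2 != 0 by rewrite gt_eqF// exprn_gt0.
have gramg : gram (g x) =
    block_mx (f x.2 ^+ 2 *: gram (gB x.1)) 0 0 (h x.1 ^+ 2 *: gram (gF x.2)).
  apply/matrixP => I J; case: (split_ordP I) => i ->; case: (split_ordP J) => j ->;
    rewrite ?block_mxEul ?block_mxEur ?block_mxEdl ?block_mxEdr mxE
      ?delta_lshift ?delta_rshift ?mxE.
  - exact: dwp_metricBB.
  - exact: dwp_metricBF.
  - by rewrite (Defs.metric_sym gR); exact: dwp_metricBF.
  - exact: dwp_metricFF.
have uB : f x.2 ^+ 2 *: gram (gB x.1) \in unitmx.
  by rewrite unitmxZ ?unitfE// gram_unit.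
have uF : h x.1 ^+ 2 *: gram (gF x.2) \in unitmx.
  by rewrite unitmxZ ?unitfE// gram_unit.
rewrite /metric_trace gramg invmx_block_diag ?unitmxE ?det_ublock ?unitrM -?unitmxE ?uB//.
have -> : gram T = block_mx
    (gram (fun u v => T (row_mx u 0) (row_mx v 0)))
    (\matrix_(i, j) T (delta_mx 0 (lshift n2 i)) (delta_mx 0 (rshift n1 j)))
    (\matrix_(i, j) T (delta_mx 0 (rshift n1 i)) (delta_mx 0 (lshift n2 j)))
    (gram (fun u v => T (row_mx 0 u) (row_mx 0 v))).
  apply/matrixP => I J; case: (split_ordP I) => i ->; case: (split_ordP J) => j ->;
    by rewrite ?block_mxEul ?block_mxEur ?block_mxEdl ?block_mxEdr !mxE
      -?delta_lshift -?delta_rshift.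
rewrite mulmx_block mxtrace_block !mul0mx addr0 add0r !invmxZ//.
by rewrite -!scalemxAl !mxtraceZ mulrC [_^-1 * _]mulrC.
Qed.

Variables (DM : covder M) (DB : covder B) (DF : covder F).
Hypothesis DM_lc : levi_civita g DM.
Hypothesis DB_lc : levi_civita gB DB.
Hypothesis DF_lc : levi_civita gF DF.

Let tder2B (p : B) (u v : 'rV[R]_n1) := tder h p u * tder h p v.
Let tder2F (q : F) (u v : 'rV[R]_n2) := tder f q u * tder f q v.

Let inv_gcoef m (N : smoothManifold R m) (k : bilin_field N) (y : N) i j :
  riemannian_metric k ->
  \sum_l gcoef k y i l y * invmx (gram (k y)) l j = (i == j)%:R.
Proof.
move=> kR; have := mulmxV (gram_unit kR y) => /matrixP/(_ i j).
rewrite !mxE => <-; apply: eq_bigr => l _.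
by rewrite !mxE gcoef_center.
Qed.

Let hessian_hM (x : M) i j : hessian DB h x.1 (delta_mx 0 i) (delta_mx 0 j) =
  partial x (lshift n2 i) (partial x (lshift n2 j) (fun y : M => h y.1)) x
  - \sum_k christoffel DB x.1 i j k x.1
      * partial x (lshift n2 k) (fun y : M => h y.1) x.
Proof.
have xx := mem_chart_dom x; have ox := @chart_dom_open _ _ _ x.
rewrite (hessian_christoffel DB i j openT I h_smooth).
congr (_ - _); last first.
  by apply: eq_bigr => k _; rewrite (partial_lshift_fst h).
rewrite -(partial_lshift_fst (partial x.1 j h) i xx); apply/esym.
by apply: (partial_near _ _ ox xx) => y xy; rewrite (partial_lshift_fst h).
Qed.

Let hessian_fM (x : M) a b : hessian DF f x.2 (delta_mx 0 a) (delta_mx 0 b) =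
  partial x (rshift n1 a) (partial x (rshift n1 b) (fun y : M => f y.2)) x
  - \sum_c christoffel DF x.2 a b c x.2
      * partial x (rshift n1 c) (fun y : M => f y.2) x.
Proof.
have xx := mem_chart_dom x; have ox := @chart_dom_open _ _ _ x.
rewrite (hessian_christoffel DF a b openT I f_smooth).
congr (_ - _); last first.
  by apply: eq_bigr => k _; rewrite (partial_rshift_snd f).
rewrite -(partial_rshift_snd (partial x.2 b f) a xx); apply/esym.
by apply: (partial_near _ _ ox xx) => y xy; rewrite (partial_rshift_snd f).
Qed.

Lemma ricci_dwpBB (x : M) j k :
  ricci DM x (row_mx (delta_mx 0 j) 0) (row_mx (delta_mx 0 k) 0) =
  ricci DB x.1 (delta_mx 0 j) (delta_mx 0 k)
  - ((n1%:R - 1) * metric_trace (gF x.2) (tder2F x.2)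
     + f x.2 * laplacian gF DF f x.2) / h x.1 ^+ 2
    * gB x.1 (delta_mx 0 j) (delta_mx 0 k)
  - n2%:R / h x.1 * hessian DB h x.1 (delta_mx 0 j) (delta_mx 0 k).
Proof.
have xx := mem_chart_dom x.
have W := dwp_warped_chart gB_riem gF_riem h_smooth f_smooth h_pos f_pos x DB_lc DF_lc.
rewrite -!delta_lshift (warped_ricci11 gR DM_lc W (V := invmx (gram (gF x.2)))); last first.
  by move=> a b; exact: inv_gcoef.
rewrite (ricci_christoffel (lc_connection DB_lc)) hessian_hM gcoef_center.
rewrite /laplacian !metric_trace_sum.
congr (_ - (_ * _ + _ * _) / _ * _ - _).
- apply: eq_bigr => i _; rewrite (partial_lshift_fst (christoffel DB x.1 j k i))//.
  by rewrite (partial_lshift_fst (christoffel DB x.1 i k i)).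
- apply: eq_bigr => a _; apply: eq_bigr => c _; rewrite /tder2F -!partial_center.
  by rewrite !(partial_rshift_snd f).
- by apply: eq_bigr => a _; apply: eq_bigr => c _; rewrite hessian_fM.
Qed.

Lemma ricci_dwpFF (x : M) j k :
  ricci DM x (row_mx 0 (delta_mx 0 j)) (row_mx 0 (delta_mx 0 k)) =
  ricci DF x.2 (delta_mx 0 j) (delta_mx 0 k)
  - ((n2%:R - 1) * metric_trace (gB x.1) (tder2B x.1)
     + h x.1 * laplacian gB DB h x.1) / f x.2 ^+ 2
    * gF x.2 (delta_mx 0 j) (delta_mx 0 k)
  - n1%:R / f x.2 * hessian DF f x.2 (delta_mx 0 j) (delta_mx 0 k).
Proof.
have xx := mem_chart_dom x.
have W := warped_chartC (dwp_warped_chart gB_riem gF_riem h_smooth f_smooth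
  h_pos f_pos x DB_lc DF_lc).
rewrite -!delta_rshift (warped_ricci11 gR DM_lc W (V := invmx (gram (gB x.1)))); last first.
  by move=> a b; exact: inv_gcoef.
rewrite (ricci_christoffel (lc_connection DF_lc)) hessian_fM gcoef_center.
rewrite /laplacian !metric_trace_sum.
congr (_ - (_ * _ + _ * _) / _ * _ - _).
- apply: eq_bigr => i _; rewrite (partial_rshift_snd (christoffel DF x.2 j k i))//.
  by rewrite (partial_rshift_snd (christoffel DF x.2 i k i)).
- apply: eq_bigr => a _; apply: eq_bigr => c _; rewrite /tder2B -!partial_center.
  by rewrite !(partial_lshift_fst h).
- by apply: eq_bigr => a _; apply: eq_bigr => c _; rewrite hessian_hM.
Qed.

Lemma scalar_curvature_dwp (x : M) :
  scalar_curvature g DM x =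
    scalar_curvature gB DB x.1 / f x.2 ^+ 2 + scalar_curvature gF DF x.2 / h x.1 ^+ 2
  - n1%:R * (n1%:R - 1) * (metric_trace (gF x.2) (tder2F x.2)
      / h x.1 ^+ 2 / f x.2 ^+ 2)
  - n2%:R * (n2%:R - 1) * (metric_trace (gB x.1) (tder2B x.1)
      / f x.2 ^+ 2 / h x.1 ^+ 2)
  - 2 * n1%:R * (laplacian gF DF f x.2 / h x.1 ^+ 2 / f x.2)
  - 2 * n2%:R * (laplacian gB DB h x.1 / f x.2 ^+ 2 / h x.1).
Proof.
have fn : f x.2 != 0 by rewrite gt_eqF.
have hn : h x.1 != 0 by rewrite gt_eqF.
rewrite /scalar_curvature metric_trace_dwp.
have -> := metric_trace_eq gB x.1 (T := fun u v => ricci DM x (row_mx u 0) (row_mx v 0))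
  (T' := fun u v => ricci DB x.1 u v
    - ((n1%:R - 1) * metric_trace (gF x.2) (tder2F x.2)
       + f x.2 * laplacian gF DF f x.2) / h x.1 ^+ 2 * gB x.1 u v
    - n2%:R / h x.1 * hessian DB h x.1 u v) (ricci_dwpBB x).
have -> := metric_trace_eq gF x.2 (T := fun u v => ricci DM x (row_mx 0 u) (row_mx 0 v))
  (T' := fun u v => ricci DF x.2 u v
    - ((n2%:R - 1) * metric_trace (gB x.1) (tder2B x.1)
       + h x.1 * laplacian gB DB h x.1) / f x.2 ^+ 2 * gF x.2 u v
    - n1%:R / f x.2 * hessian DF f x.2 u v) (ricci_dwpFF x).
rewrite !metric_trace_lin (metric_trace_metric gB_riem) (metric_trace_metric gF_riem).
rewrite -/(laplacian gB DB h x.1) -/(laplacian gF DF f x.2).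
by field; rewrite fn hn.
Qed.

Lemma grad_norm_fM (x : M) :
  let fM : M -> R := fun y => f y.2 in
  g x (grad g fM x) (grad g fM x) = metric_trace (gF x.2) (tder2F x.2) / h x.1 ^+ 2.
Proof.
rewrite /= (grad_norm gR) metric_trace_dwp metric_trace_sum big1 => [|i _].
  rewrite mul0r add0r; congr (_ / _); apply: metric_trace_eq => j k.
  by rewrite !tder_snd !row_mxKr.
by rewrite big1// => j _; rewrite tder_snd row_mxKr tder0 mul0r mulr0.
Qed.

Lemma grad_norm_hM (x : M) :
  let hM : M -> R := fun y => h y.1 in
  g x (grad g hM x) (grad g hM x) = metric_trace (gB x.1) (tder2B x.1) / f x.2 ^+ 2.
Proof.
rewrite /= (grad_norm gR) metric_trace_dwp addrC metric_trace_sum big1 => [|i _].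
  rewrite mul0r add0r; congr (_ / _); apply: metric_trace_eq => j k.
  by rewrite !tder_fst !row_mxKl.
by rewrite big1// => j _; rewrite tder_fst row_mxKl tder0 mul0r mulr0.
Qed.

Variables (P : vfield B) (P_smooth : smooth_vfield_on setT P).

(** For V tangent to F, nabla_V P = (P(h) / h) V: the directions tangent to F
    contribute n2 terms P(h) / h. *)
Lemma divergence_dwp (x : M) :
  \tr (lin1_mx (fun u => DM x u (liftB P))) =
  \tr (lin1_mx (fun u => DB x.1 u P))
  + n2%:R * (tder (fun y : M => h y.1) x (liftB P x) / h x.1).
Proof.
have xx := mem_chart_dom x; have ox := @chart_dom_open _ _ _ x.
have [x1 x2] := xx.
have W := dwp_warped_chart gB_riem gF_riem h_smooth f_smooth h_pos f_pos x DB_lc DF_lc.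
have Wc := warped_chartC W.
have sPM : smooth_vfield_on (chart_dom x) (liftB P : vfield M).
  exact: smooth_vfield_sub (@subsetT _ _) (smooth_liftB P_smooth).
have sPB : smooth_vfield_on (chart_dom x.1) P.
  exact: smooth_vfield_sub (@subsetT _ _) P_smooth.
have PR a (y : M) : coframe x (rshift n1 a) y (liftB P y) = 0.
  by rewrite coframe_rshift row_mxKr coframe0.
have PL i (y : M) : coframe x (lshift n2 i) y (liftB P y) = coframe x.1 i y.1 (P y.1).
  by rewrite coframe_lshift row_mxKl.
have covE I : (DM x (delta_mx 0 I) (liftB P)) 0 I =
    partial x I (fun y => coframe x I y (liftB P y)) x
    + \sum_j coframe x.1 j x.1 (P x.1) * christoffel DM x I (lshift n2 j) I x.
  rewrite -(coframe_center x) -[in LHS](frame_center x I).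
  rewrite (coframe_covder (lc_connection DM_lc) I I ox (@subset_refl _ _) xx sPM).
  rewrite big_split_ord /= [X in _ + (_ + X)]big1 ?addr0 => [|a _]; last first.
    by rewrite PR mul0r.
  by congr (_ + _); apply: eq_bigr => j _; rewrite PL.
rewrite /mxtrace big_split_ord /=; congr (_ + _).
  apply: eq_bigr => i _; rewrite !mxE covE.
  rewrite -(coframe_center x.1) -[in RHS](frame_center x.1 i).
  rewrite (coframe_covder (lc_connection DB_lc) i i (@chart_dom_open _ _ _ x.1)
    (@subset_refl _ _) x1 sPB).
  congr (_ + _).
    rewrite -(partial_lshift_fst (fun y => coframe x.1 i y (P y)) i xx).
    by apply: (partial_near _ _ ox xx) => y _; exact: PL.
  by apply: eq_bigr => j _; rewrite (warped_christoffel111 gR DM_lc W).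
rewrite tder_fst /liftB row_mxKl {1}(frame_decomposition (P x.1) x1).
rewrite (tder_partial _ _ (I : setT x.1) h_smooth).
transitivity (\sum_(a < n2) (\sum_j coframe x.1 j x.1 (P x.1) * partial x.1 j h x.1)
    / h x.1).
  apply: eq_bigr => a _; rewrite !mxE covE.
  rewrite (partial_near (g := fun=> 0) x (rshift n1 a) ox xx) => [|y _]; last exact: PR.
  rewrite partial_cst add0r mulr_suml; apply: eq_bigr => j _.
  rewrite (warped_christoffel121 gR DM_lc Wc)// eqxx mulr1 mulrA.
  by rewrite (partial_lshift_fst h).
by rewrite sumr_const card_ord mulr_natl.
Qed.

End DoublyWarpedProduct.

Theorem corollary4p7 (R : realType) (n1 n2 : nat)
    (B : smoothManifold R n1) (F : smoothManifold R n2)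
    (gB : bilin_field B) (gF : bilin_field F)
    (gB_riem : riemannian_metric gB) (gF_riem : riemannian_metric gF)
    (h : B -> R) (f : F -> R)
    (h_smooth : smooth_fun_on setT h) (f_smooth : smooth_fun_on setT f)
    (h_pos : forall p, 0 < h p) (f_pos : forall q, 0 < f q)
    (P : vfield B) (P_smooth : smooth_vfield_on setT P)
    (DM : covder (prod_manifold B F)) (DB : covder B) (DF : covder F)
    (DM_lc : levi_civita (dwp_metric gB gF f h) DM)
    (DB_lc : levi_civita gB DB) (DF_lc : levi_civita gF DF)
    (p : B) (q : F) (e : 'I_n1 -> 'rV[R]_n1)
    (e_frame : orthonormal_frame (leafB (dwp_metric gB gF f h) q p) e) :
  let g := dwp_metric gB gF f h in
  let PM := liftB P in
  let fM : prod_manifold B F -> R := fun x => f x.2 in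
  let hM : prod_manifold B F -> R := fun x => h x.1 in
  let x : prod_manifold B F := (p, q) in
  let n := (n1 + n2)%N in
  scalar_curvature g (semi_symmetric g DM PM) x
  = scalar_curvature gB (semi_symmetric (leafB g q) DB P) p / f q ^+ 2
    + scalar_curvature gF DF q / h p ^+ 2
    - n1%:R * (n1%:R - 1) * (g x (grad g fM x) (grad g fM x) / f q ^+ 2)
    - n2%:R * (n2%:R - 1) * (g x (grad g hM x) (grad g hM x) / h p ^+ 2)
    - 2 * n2%:R * (n%:R - 1) * (tder hM x (PM x) / h p)
    - 2 * n1%:R * (laplacian (leafF g p) DF f q / f q)
    - 2 * n2%:R * (laplacian (leafB g q) DB h p / h p)
    - 2 * n2%:R * divergence (leafB g q) DB P p e
    - n2%:R * (n%:R + n1%:R - 3) * g x (PM x) (PM x).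
Proof.
move=> g PM fM hM x n.
have f0 : 0 < f q ^+ 2 by rewrite exprn_gt0.
have h0 : 0 < h p ^+ 2 by rewrite exprn_gt0.
have gR : riemannian_metric g by exact: dwp_riemannian.
have leafBE : leafB g q = fun y u v => f q ^+ 2 * gB y u v.
  by do 3![apply/funext => ?]; exact: dwp_metricBB.
have leafFE : leafF g p = fun y u v => h p ^+ 2 * gF y u v.
  by do 3![apply/funext => ?]; exact: dwp_metricFF.
have LR : riemannian_metric (leafB g q).
  by rewrite leafBE; exact: scaled_riemannian.
have lcL : levi_civita (leafB g q) DB.
  by rewrite leafBE; exact: scaled_levi_civita.
have scalB D' : scalar_curvature (leafB g q) D' p = scalar_curvature gB D' p / f q ^+ 2.
  by rewrite leafBE; exact: metric_trace_scaled.
have PP : g x (PM x) (PM x) = leafB g q p (P p) (P p) by [].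
rewrite (scalar_curvature_semi_symmetric gR (smooth_liftB P_smooth) DM_lc).
rewrite -scalB (scalar_curvature_semi_symmetric LR P_smooth lcL) scalB.
rewrite (divergence_trace LR (lc_connection lcL) P_smooth e_frame).
rewrite (divergence_dwp gB_riem gF_riem h_smooth f_smooth h_pos f_pos DM_lc DB_lc DF_lc P_smooth).
rewrite (scalar_curvature_dwp gB_riem gF_riem h_smooth f_smooth h_pos f_pos DM_lc DB_lc DF_lc).
have NF := grad_norm_fM gB_riem gF_riem h_smooth f_smooth h_pos f_pos x.
have NH := grad_norm_hM gB_riem gF_riem h_smooth f_smooth h_pos f_pos x.
rewrite [g x (grad g fM x) _]NF [g x (grad g hM x) _]NH.
have lapB : laplacian (leafB g q) DB h p = laplacian gB DB h p / f q ^+ 2.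
  by rewrite leafBE; exact: metric_trace_scaled.
have lapF : laplacian (leafF g p) DF f q = laplacian gF DF f q / h p ^+ 2.
  by rewrite leafFE; exact: metric_trace_scaled.
rewrite lapB lapF PP natrD /=.
by ring.
Qed.
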